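(* Let $I=[0,1]$ and let $f\in\mathrm{Diff}_+^1(I)$ be such that $f$ has no fixed point in $(0,1)$ and $f'(0)=f'(1)=1$. Then for every $r>0$ there exist $g\in\mathrm{Diff}_+^1(I)$ and a positive integer $N$ such that $g$ is $r$-close to the identity and $g^N$ is $r$-close to $f$ in the $C^1$ metric, where $g^N$ denotes the $N$-fold composition of $g$ with itself.
   Context: $\mathrm{Diff}_+^1(I)$ is the group, under composition, of $C^1$ bijections $f:[0,1]\to[0,1]$ with $f(0)=0$, $f(1)=1$ and $f'>0$ on $[0,1]$ (one-sided derivatives at the endpoints). Two elements $f,g$ are $r$-close in the $C^1$ metric if $\sup_{x\in I}|f'(x)-g'(x)|<r$ (since $f(0)=g(0)$, this also gives $\sup_{x\in I}|f(x)-g(x)|<r$). *)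

(* Defs.v *)
From HB Require Import structures.
From mathcomp Require Import all_boot all_order all_algebra.
From mathcomp Require Import all_classical all_reals all_analysis.
Import Order.TTheory GRing.Theory Num.Theory.
Import numFieldNormedType.Exports.

Set Implicit Arguments.
Unset Strict Implicit.
Unset Printing Implicit Defensive.

Local Open Scope classical_set_scope.
Local Open Scope ring_scope.

(* Self-maps of [0, 1] are represented by functions [f : R -> R] of which only
   the values on [0, 1] are used. *)

Definition unit_itv (R : realType) : set R := `[0, 1]%classic.
Arguments unit_itv R : clear implicits.

(* The limit of the difference quotient is taken along the punctured
   neighbourhoods of [x] inside [0, 1]: for [0 < x < 1] it is the usual
   two-sided derivative, at [0] and [1] it is the one-sided derivative. *)
Definition quot_at (R : realType) (f : R -> R) (x : R) : set_system R :=
  (f y - f x) / (y - x) @[y --> within (unit_itv R) x^'].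

Definition derivable_at (R : realType) (f : R -> R) (x : R) : Prop :=
  cvg (quot_at f x).

(* Only meaningful when [derivable_at f x]. *)
Definition deriv_at (R : realType) (f : R -> R) (x : R) : R :=
  lim (quot_at f x).

Record diffeo1 (R : realType) (f : R -> R) : Prop := Diffeo1 {
  diffeo1_bij : set_bij (unit_itv R) (unit_itv R) f ;
  diffeo1_0 : f 0 = 0 ;
  diffeo1_1 : f 1 = 1 ;
  diffeo1_derivable : forall x, unit_itv R x -> derivable_at f x ;
  diffeo1_continuous : {within unit_itv R, continuous (deriv_at f)} ;
  diffeo1_gt0 : forall x, unit_itv R x -> 0 < deriv_at f x
}.

(* The supremum is taken in the extended reals, so that an unbounded set of
   values has supremum [+oo] (the real-valued [sup] would give [0]). *)
Definition C1_close (R : realType) (r : R) (f g : R -> R) : Prop :=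
  (ereal_sup [set (`|deriv_at f x - deriv_at g x|)%:E | x in unit_itv R]
    < r%:E)%E.

(* Main.v *)
Require Import Defs.
From HB Require Import structures.
From mathcomp Require Import all_boot all_order all_algebra.
From mathcomp Require Import all_classical all_reals all_analysis.
From mathcomp Require Import ring lra.
Import Order.TTheory GRing.Theory Num.Theory.
Import numFieldNormedType.Exports.

Set Implicit Arguments.
Unset Strict Implicit.
Unset Printing Implicit Defensive.

Local Open Scope classical_set_scope.
Local Open Scope ring_scope.

(* Reflecting if necessary, [x < f x] on (0, 1). Extended by the identity, [f]
   is a C^1 diffeomorphism [F] of the line, and an orbit of [F] is interpolated
   by a C^1 embedding [phi] of the line onto (0, 1) with
   [phi (t + 1) = F (phi t)]. The shifts by [1/N], conjugated by [phi], are
   roots of [F], but in general they are not C^1 at 0 and 1: near the ends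
   [phi' (t + s) / phi' t] is close to 1 for [s = 1], because
   [F' 0 = F' 1 = 1], but not for fractional [s]. Replace [phi] by
     [psi t = (1 - eta) (phi t + eta e^(kt)) / (1 + eta (e^(kt) + e^(-kt)))
              + eta (1/2 + atan t / pi)].
   On a compact set [psi' (t + 1) / psi' t] tends to [F' (phi t)] as [eta] tends
   to 0; outside, every ingredient of [psi'] changes by a factor close to 1 over
   a unit of time, so that both [psi' (t + 1) / psi' t] and [F' (psi t)] are
   close to 1. Thus the conjugate by [psi] of the unit shift is C^1-close to
   [F]. Moreover [phi'] grows at most like [e^(k|t|/2)], so the arctangent
   dominates [psi'] at infinity; hence [psi' (t + s) / psi' t] tends to 1 at
   infinity, uniformly in [0 <= s <= 1]. This makes the conjugated shifts C^1 at
   0 and 1, and close to the identity for small [s]. *)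

(** * C^1 diffeomorphisms of the line *)

Section C1pos.
Variable R : realType.
Implicit Types (F G dF dG : R -> R) (x y : R).

(** The derivative is carried as an explicit function, so that the formulas for compositions and
    inverses need no limits. Surjectivity is left out; conjugating maps onto (0, 1) must qualify as
    well. *)
Definition C1pos F dF : Prop :=
  [/\ forall x, is_derive x 1 F (dF x), continuous dF & forall x, 0 < dF x].

(** Carathéodory's slope function is the difference quotient completed by the value [a] at [x]. This
    links the library derivative to the quotients of [quot_at]. *)
Lemma is_derive_slopeP F x a :
  is_derive x 1 F a <-> (F y - F x) / (y - x) @[y --> x^'] --> a.
Proof.
split=> [/is_derive1_caratheodory [h [hE hc hx]]|H].
  have : h @ x^' --> a.
    by rewrite -hx; apply: cvg_trans hc; apply: cvg_app; exact: nbhs_dnbhs.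
  apply: cvg_trans; apply: near_eq_cvg.
  near=> y; rewrite hE mulfK// subr_eq0.
  by near: y; exact: nbhs_dnbhs_neq.
apply/is_derive1_caratheodory.
exists (fun y => if y == x then a else (F y - F x) / (y - x)); split.
- move=> z; case: eqP => [->|/eqP zx]; first by rewrite !subrr mulr0.
  by rewrite divfK// subr_eq0.
- apply/continuous_withinNx; rewrite eqxx.
  apply: cvg_trans H; apply: near_eq_cvg.
  near=> y; rewrite ifN//.
  by near: y; exact: nbhs_dnbhs_neq.
- by rewrite eqxx.
Unshelve. all: by end_near. Qed.

(* The library instances in pointwise form, with [*] instead of [*:]. *)
Lemma is_derive1D F G x a b : is_derive x 1 F a -> is_derive x 1 G b ->
  is_derive x 1 (fun y => F y + G y) (a + b).
Proof. exact: is_deriveD. Qed.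

Lemma is_derive1B F G x a b : is_derive x 1 F a -> is_derive x 1 G b ->
  is_derive x 1 (fun y => F y - G y) (a - b).
Proof. exact: is_deriveB. Qed.

Lemma is_derive1Z F x k a : is_derive x 1 F a ->
  is_derive x 1 (fun y => k * F y) (k * a).
Proof. exact: is_deriveZ. Qed.

Lemma is_derive1M F G x a b : is_derive x 1 F a -> is_derive x 1 G b ->
  is_derive x 1 (fun y => F y * G y) (a * G x + F x * b).
Proof.
move=> Fd Gd; apply: is_derive_eq (is_deriveM Fd Gd) _.
by rewrite addrC; congr (_ + _); exact: mulrC.
Qed.

Lemma is_derive1V F x a : F x != 0 -> is_derive x 1 F a ->
  is_derive x 1 (fun y => (F y)^-1) (- a / F x ^+ 2).
Proof.
move=> F0 Fd; apply: is_derive_eq (is_deriveV F0 Fd) _.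
by rewrite mulrC mulrN -mulNr.
Qed.

Lemma is_derive1_affine x k a : is_derive x 1 (fun y => k * y + a) k.
Proof.
apply: is_derive_eq (is_derive1D (is_derive1Z k (is_derive_id x 1))
  (is_derive_cst a x 1)) _.
by rewrite mulr1 addr0.
Qed.

Lemma is_derive_continuous F x a : is_derive x 1 F a -> {for x, continuous F}.
Proof. by move=> [d _]; apply/differentiable_continuous/derivable1_diffP. Qed.

Lemma C1pos_continuous F dF : C1pos F dF -> continuous F.
Proof. by move=> [d _ _] x; exact: is_derive_continuous (d x). Qed.

Lemma C1pos_lt F dF : C1pos F dF -> {mono F : x y / x < y}.
Proof.
move=> FC; have [d _ p] := FC.
suff H : {homo F : x y / x < y} by exact: leW_mono (le_mono H).
move=> x y xy.
have [|c _ E] := @MVT R F dF _ _ xy (fun z _ => d z).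
  exact/continuous_subspaceT/(C1pos_continuous FC).
by rewrite -subr_gt0 E mulr_gt0// subr_gt0.
Qed.

Lemma C1pos_le F dF : C1pos F dF -> {mono F : x y / x <= y}.
Proof. by move=> /C1pos_lt h x y; rewrite !leNgt h. Qed.

Lemma C1pos_id : C1pos id (cst 1).
Proof. by split=> [x|x|x]; [exact: is_derive_id|exact: cst_continuous|exact: ltr01]. Qed.

Lemma C1pos_comp F dF G dG : C1pos F dF -> C1pos G dG ->
  C1pos (F \o G) (fun x => dF (G x) * dG x).
Proof.
move=> [Fd Fc Fp] Gh; have [Gd Gc Gp] := Gh; split=> [x|x|x].
- exact: is_derive1_comp.
- apply: cvgM; last exact: Gc.
  by apply: continuous_comp; [exact: C1pos_continuous Gh _|exact: Fc].
- exact: mulr_gt0.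
Qed.

Lemma C1pos_inv F dF G : C1pos F dF -> cancel F G -> cancel G F ->
  C1pos G (fun x => (dF (G x))^-1).
Proof.
move=> FC FG GF; have [Fd Fc Fp] := FC.
have Gd x : is_derive x 1 G (dF (G x))^-1.
  rewrite -{1}(GF x); apply: is_derive_inverse => //.
  - by near=> z; exact: FG.
  - by near=> z; exact: C1pos_continuous FC _.
  - by rewrite gt_eqF.
split=> // [x|x]; last by rewrite invr_gt0.
apply: cvgV; first by rewrite gt_eqF.
by apply: continuous_comp; [exact: is_derive_continuous (Gd x)|exact: Fc].
Unshelve. all: by end_near. Qed.

(* By the mean value theorem the slopes at [x] are values of [dF] near [x]. *)
Lemma is_derive_removable F dF x :
    continuous F -> {for x, continuous dF} ->
    (\forall y \near x^', is_derive (y : R) 1 F (dF y)) ->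
  is_derive x 1 F (dF x).
Proof.
move=> Fc dFc Fd; apply/is_derive_slopeP/cvgrPdist_lt => e e0.
move/cvgrPdist_lt : dFc => /(_ e e0).
move: Fd; rewrite /dnbhs near_withinE => /[swap] /filterI/[apply].
move=> /nbhs_ballP[d /= d0 H].
rewrite near_withinE; apply/nbhs_ballP; exists d => //= y xy yx.
have between c : (x < c < y) || (y < c < x) -> ball x d c /\ c != x.
  move: xy; rewrite /ball/= !ltr_norml => /andP[? ?] cI.
  split; last by rewrite neq_lt; move: cI; lra.
  by move: cI; lra.
have Fd c : (x < c < y) || (y < c < x) -> is_derive c 1 F (dF c).
  by move=> /between[/H[_]]; exact.
have dFx c : (x < c < y) || (y < c < x) -> `|dF x - dF c| < e.
  by move=> /between[/H[]].
have Fw a b : {within `[a, b], continuous F} by exact: continuous_subspaceT.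
case: (ltgtP x y) => [lxy|lyx|E]; last by rewrite E eqxx in yx.
- have [c|//|c /[!in_itv]/= cI ->] := @MVT R F dF _ _ lxy.
    by rewrite in_itv/= => cI; apply: Fd; rewrite cI.
  by rewrite mulfK ?subr_eq0//; apply: dFx; rewrite cI.
- have [c|//|c /[!in_itv]/= cI E] := @MVT R F dF _ _ lyx.
    by rewrite in_itv/= => cI; apply: Fd; rewrite cI orbT.
  rewrite -(opprB (F x)) E -(opprB x y) invrN mulrNN mulfK ?subr_eq0 1?eq_sym//.
  by apply: dFx; rewrite cI orbT.
Qed.

End C1pos.

(** * Maps of the unit interval *)

Section unit_interval.
Variable R : realType.
Implicit Types (F G f g dF dG : R -> R) (x y : R).

(** The retraction of the line onto [0, 1]: composing with it extends a function by its endpoint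
    values. *)
Definition clamp01 x : R := Num.max 0 (Num.min 1 x).

Definition ext01 f x := if 0 <= x <= 1 then f x else x.

Lemma unit_itvE x : unit_itv R x = (0 <= x <= 1) :> Prop.
Proof. by rewrite /unit_itv/= in_itv. Qed.

Lemma clamp01_unit x : unit_itv R (clamp01 x).
Proof. by rewrite unit_itvE /clamp01 le_max lexx/= ge_max ler01/= ge_min lexx. Qed.

Lemma clamp01_id x : unit_itv R x -> clamp01 x = x.
Proof.
by rewrite unit_itvE /clamp01 => /andP[x0 x1]; rewrite min_r// max_r.
Qed.

Lemma continuous_clamp01 : continuous clamp01.
Proof.
move=> x; have c a : {for x, continuous (cst a : R -> R^o)} by exact: cst_continuous.
apply: (@continuous_max R R (cst 0) (cst 1 \min id) x) => //.
exact: (@continuous_min R R (cst 1) id x).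
Qed.

Lemma continuous_comp_clamp01 g :
  {within unit_itv R, continuous g} -> continuous (g \o clamp01).
Proof.
move=> /subspace_continuousP gc x.
apply: (@cvg_comp _ _ _ clamp01 g _ (within (unit_itv R) (nbhs (clamp01 x)))).
  move=> U /(continuous_clamp01 (x := x)); apply: (@filterS _ (nbhs x)) => y.
  by apply; exact: clamp01_unit.
exact/gc/clamp01_unit.
Qed.

(** The endpoint derivatives equal the slope of the identity, so the two pieces of [ext01 f] fit
    together in a C^1 way. *)
Lemma diffeo1_C1pos f : diffeo1 f -> deriv_at f 0 = 1 -> deriv_at f 1 = 1 ->
  C1pos (ext01 f) (deriv_at f \o clamp01).
Proof.
move=> [_ f0 f1 fd fc fp] df0 df1; split=> [x|x|x] /=; last 2 first.
- exact: continuous_comp_clamp01.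
- exact/fp/clamp01_unit.
have ext_out y : ~~ (0 <= y <= 1) -> ext01 f y = y.
  by rewrite /ext01 => /negbTE ->.
case: (boolP (0 <= x <= 1)) => xI; last first.
  have -> : deriv_at f (clamp01 x) = 1.
    rewrite /clamp01; move: xI; rewrite negb_and -!ltNge => /orP[x0|x1].
      by rewrite min_r ?max_l ?df0// ltW// (lt_trans x0).
    by rewrite min_l ?max_r ?df1// ltW.
  apply: near_eq_is_derive (is_derive_id x 1).
  move: xI; rewrite negb_and -!ltNge => /orP[x0|x1].
    near=> y; rewrite ext_out// negb_and -!ltNge; apply/orP; left.
    by near: y; exact: lt_nbhsl.
  near=> y; rewrite ext_out// negb_and -!ltNge; apply/orP; right.
  by near: y; exact: lt_nbhsr.
have xu : unit_itv R x by rewrite unit_itvE.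
rewrite clamp01_id//; apply/is_derive_slopeP/cvgrPdist_lt => e e0.
have /cvgrPdist_lt/(_ e e0) := fd _ xu; rewrite near_withinE => H.
have [x01|x01] := boolP (0 < x < 1).
  near=> y; rewrite /ext01 xI.
  have yI : 0 <= y <= 1.
    near: y; apply: nbhs_dnbhs; have /andP[x0 x1] := x01.
    near=> y; apply/andP; split; apply/ltW; near: y.
      exact: lt_nbhsr.
    exact: lt_nbhsl.
  rewrite yI; have := (near H y).
  by rewrite unit_itvE; apply.
(* At an endpoint, quotients taken from inside [0, 1] are those of [f], and those from outside equal
   1. *)
have [fx dx] : f x = x /\ deriv_at f x = 1.
  have [->//|->//] : x = 0 \/ x = 1.
  move: xI x01 => /andP[]; rewrite le_eqVlt => /predU1P[<-|x0]; first by left.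
  by rewrite le_eqVlt => /predU1P[->|x1]; [right|rewrite x0 x1].
near=> y; have [yI|yI] := boolP (0 <= y <= 1).
  rewrite /ext01 xI yI; have := near H y.
  by rewrite unit_itvE; apply.
rewrite ext_out// /ext01 xI fx dx divff ?subrr ?normr0//.
by rewrite subr_eq0; apply: contraNneq yI => ->.
Unshelve. all: by end_near. Qed.

Lemma ext01_fix f x : f 0 = 0 -> f 1 = 1 -> ~~ (0 < x < 1) -> ext01 f x = x.
Proof.
move=> f0 f1; rewrite /ext01; case: ifP => // /andP[].
rewrite le_eqVlt => /predU1P[<-|x0]//.
by rewrite le_eqVlt => /predU1P[->|x1]//; rewrite x0 x1.
Qed.

(** Properness makes [deriv_at] a genuine, unique limit. A step of length at most 1/4 towards the
    farther end stays in [0, 1]. *)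
Lemma within_unit_dnbhs_proper x : unit_itv R x ->
  ProperFilter (within (unit_itv R) x^').
Proof.
rewrite unit_itvE => /andP[x0 x1]; split; last exact: within_filter.
rewrite /within/= /dnbhs /within/= => /nbhs_ballP[d /= d0 H].
pose h := Num.min (d / 2) (1 / 4).
have h0 : 0 < h by rewrite lt_min !divr_gt0.
have hd : h < d by rewrite gt_min; apply/orP; left; lra.
have h1 : h <= 1 / 4 by rewrite ge_min lexx orbT.
have [xh|xh] := leP x (1 / 2).
  apply: (H (x + h)); rewrite /ball/= ?unit_itvE.
  - by rewrite opprD addNKr normrN gtr0_norm.
  - by rewrite gt_eqF//; lra.
  - by apply/andP; split; lra.
apply: (H (x - h)); rewrite /ball/= ?unit_itvE.
- by rewrite opprB addrC subrK gtr0_norm.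
- by rewrite lt_eqF//; lra.
- by apply/andP; split; lra.
Qed.

Lemma C1pos_quot_at G dG x : C1pos G dG -> quot_at G x --> dG x.
Proof.
move=> [/(_ x) /is_derive_slopeP Gd _ _].
by apply: cvg_trans Gd; apply: cvg_app; exact: cvg_within.
Qed.

Lemma C1pos_deriv_at G dG x : C1pos G dG -> unit_itv R x ->
  deriv_at G x = dG x.
Proof.
move=> Gd xu; have := within_unit_dnbhs_proper xu => xp.
by apply: cvg_lim; [exact: norm_hausdorff|exact: C1pos_quot_at].
Qed.

Lemma C1pos_diffeo1 G dG : C1pos G dG -> G 0 = 0 -> G 1 = 1 -> diffeo1 G.
Proof.
move=> GC G0 G1; have [Gd Gc Gp] := GC; split => //.
- split=> [y|y z _ _ E|y].
  + by rewrite !unit_itvE -{2}G0 -{2}G1 !(C1pos_le GC).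
  + by apply/le_anti/andP; split; rewrite -(C1pos_le GC) E.
  + rewrite unit_itvE => yI.
    have [||c /[!in_itv] cI <-] := @IVT R G 0 1 y ler01.
    * exact/continuous_subspaceT/(C1pos_continuous GC).
    * by rewrite G0 G1 min_l ?max_r.
    * by exists c => //; rewrite unit_itvE.
- by move=> x _; apply/cvg_ex; exists (dG x); exact: C1pos_quot_at.
- apply/subspace_continuousP => x xu.
  change (deriv_at G @ within (unit_itv R) (nbhs x) --> deriv_at G x).
  have -> : deriv_at G x = dG x by exact: C1pos_deriv_at.
  have : dG @ within (unit_itv R) (nbhs x) --> dG x.
    by apply: cvg_trans (Gc x); apply: cvg_app; exact: cvg_within.
  apply: cvg_trans; apply: near_eq_cvg.
  rewrite near_withinE; near=> y => yu.
  by apply/esym; exact: C1pos_deriv_at.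
- by move=> x xu; rewrite (C1pos_deriv_at GC xu).
Unshelve. all: by end_near. Qed.

(** A pointwise bound by [r] would leave the supremum possibly equal to [r]; halving makes the
    inequality strict. *)
Lemma C1_close_le r f g : 0 < r ->
  (forall x, unit_itv R x -> `|deriv_at f x - deriv_at g x| <= r / 2) ->
  C1_close r f g.
Proof.
move=> r0 H; rewrite /C1_close (@le_lt_trans _ _ (r / 2)%:E)//; last first.
  by rewrite lte_fin; lra.
by apply: ge_ereal_sup => _ [x xu <-]; rewrite lee_fin; exact: H.
Qed.

(** Conjugation by the reflection of [0, 1], which exchanges the cases [F x < x] and [x < F x]. *)
Definition flip F x : R := 1 - F (1 - x).

Lemma iter_flip F N : iter N (flip F) = flip (iter N F).
Proof.
apply/funext => x; elim: N => [|N IH]; first by rewrite /flip/= subKr.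
by rewrite !iterS IH /flip /= subKr.
Qed.

Lemma C1pos_flip F dF : C1pos F dF -> C1pos (flip F) (fun x => dF (1 - x)).
Proof.
move=> [Fd Fc Fp].
have sub_d x : is_derive x 1 (fun y => 1 - y : R) (-1).
  apply: is_derive_eq (is_deriveB (is_derive_cst (1 : R) x 1) (is_derive_id x 1)) _.
  by rewrite sub0r.
split=> [x|x|x]; last exact: Fp.
- have := Fd (1 - x) => d.
  have := @is_derive1_comp R F _ x _ _ d (sub_d x) => dc.
  apply: is_derive_eq (is_deriveB (is_derive_cst (1 : R) x 1) dc) _.
  by rewrite sub0r mulrN1 opprK.
- apply: continuous_comp; last exact: Fc.
  exact: is_derive_continuous (sub_d x).
Qed.

End unit_interval.

(** * Interpolation of an orbit *)

Section smooth_step.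
Variable R : realType.
Implicit Types (t : R).

Let pos t : R := Num.max 0 t.

Let posE t : (pos t = 0 /\ t <= 0) \/ (pos t = t /\ 0 <= t).
Proof.
by rewrite /pos; case: (leP 0 t) => t0; [right|left]; split=> //; exact: ltW.
Qed.

Let continuous_pos : continuous pos.
Proof.
by move=> x; apply: (@continuous_max R R (cst 0) id x) => //; exact: cst_continuous.
Qed.

(** Away from 0 the function is locally 0 or a square; [is_derive_removable] settles the point 0. *)
Let is_derive_pos_sqr t : is_derive t 1 (fun u => pos u ^+ 2) (2 * pos t).
Proof.
apply: (@is_derive_removable _ (fun u => pos u ^+ 2) (fun u => 2 * pos u)).
- by move=> x; apply: cvgM; exact: continuous_pos.
- by apply: cvgMr; exact: continuous_pos.
have sqr0 (u : R) : u < 0 -> is_derive u 1 (fun v => pos v ^+ 2) (2 * pos u).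
  move=> u0; have [[-> _]|[_ /(lt_le_trans u0)]] := posE u; last by rewrite ltxx.
  rewrite mulr0; apply: near_eq_is_derive (is_derive_cst 0 u 1).
  near=> v; have [[-> _]|[_ v0]] := posE v; first by rewrite expr0n.
  suff : v < 0 by rewrite ltNge v0.
  by near: v; exact: lt_nbhsl.
have sqr1 (u : R) : 0 < u -> is_derive u 1 (fun v => pos v ^+ 2) (2 * pos u).
  move=> u0; have [[_ /(lt_le_trans u0)]|[-> _]] := posE u; first by rewrite ltxx.
  apply: (@near_eq_is_derive R R R (fun v => v ^+ 2) _ u 1).
    near=> v; have [[_ v0]|[-> _]] := posE v => //.
    suff : 0 < v by rewrite ltNge v0.
    by near: v; exact: lt_nbhsr.
  apply: is_derive_eq (is_deriveX 2 (is_derive_id u 1)) _.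
  by rewrite [_ *: _]mulr1.
have [t0|t0|->] := ltgtP t 0.
- apply: nbhs_dnbhs; near=> u; apply: sqr0; near: u; exact: lt_nbhsl.
- apply: nbhs_dnbhs; near=> u; apply: sqr1; near: u; exact: lt_nbhsr.
- near=> u; have : u != 0 by near: u; exact: nbhs_dnbhs_neq.
  by rewrite neq_lt => /orP[/sqr0|/sqr1].
Unshelve. all: by end_near. Qed.

(** A quadratic spline with knots 1/3, 1/2 and 2/3 is smooth enough. Its flat outer parts let
    successive pieces of the orbit overlap. *)
Lemma smooth_step : exists c dc : R -> R,
  [/\ forall t, is_derive t 1 c (dc t), continuous dc,
      forall t, 0 <= dc t,
      forall t, 0 <= c t <= 1
    & (forall t, t <= 1 / 3 -> c t = 0 /\ dc t = 0) /\
      (forall t, 2 / 3 <= t -> c t = 1 /\ dc t = 0)].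
Proof.
pose u a t : R := 3 * t + - a.
pose c t := 2 * pos (u 1 t) ^+ 2 - 4 * pos (u (3 / 2) t) ^+ 2
            + 2 * pos (u 2 t) ^+ 2.
(* [dc] is a tent supported by [1/3, 2/3]. *)
pose dc t := 12 * pos (u 1 t) - 24 * pos (u (3 / 2) t) + 12 * pos (u 2 t).
have du a t : is_derive t 1 (u a) 3.
  exact: is_derive1_affine.
have dpu a b t : is_derive t 1 (fun t => b * pos (u a t) ^+ 2) (b * (6 * pos (u a t))).
  have := is_derive1_comp (is_derive_pos_sqr (u a t)) (du a t) => d.
  by apply: is_derive_eq (is_derive1Z b d) _; ring.
have cpu a : continuous (fun t => pos (u a t)).
  move=> t; apply: continuous_comp; last exact: continuous_pos.
  exact: is_derive_continuous (du a t).
exists c, dc; split.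
- move=> t.
  apply: is_derive_eq (is_derive1D (is_derive1B (dpu 1 2 t) (dpu (3 / 2) 4 t)) (dpu 2 2 t)) _.
  by rewrite /dc; ring.
- move=> t; apply: cvgD; last by apply: cvgMr; exact: cpu.
  by apply: cvgB; apply: cvgMr; exact: cpu.
- move=> t; rewrite /dc; have := (posE (u 1 t), posE (u (3 / 2) t), posE (u 2 t)).
  by rewrite /u => -[[[[-> ?]|[-> ?]] [[-> ?]|[-> ?]]] [[-> ?]|[-> ?]]]; lra.
- move=> t; rewrite /c; have := (posE (u 1 t), posE (u (3 / 2) t), posE (u 2 t)).
  by rewrite /u => -[[[[-> ?]|[-> ?]] [[-> ?]|[-> ?]]] [[-> ?]|[-> ?]]]; nra.
- split=> t tI; rewrite /c /dc.
  + have := (posE (u 1 t), posE (u (3 / 2) t), posE (u 2 t)).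
    by rewrite /u => -[[[[-> ?]|[-> ?]] [[-> ?]|[-> ?]]] [[-> ?]|[-> ?]]]; nra.
  + have := (posE (u 1 t), posE (u (3 / 2) t), posE (u 2 t)).
    by rewrite /u => -[[[[-> ?]|[-> ?]] [[-> ?]|[-> ?]]] [[-> ?]|[-> ?]]]; nra.
Qed.

End smooth_step.

Section orbit_parametrization.
Variable R : realType.
Implicit Types (F dF G phi Q : R -> R) (x y t : R).

(** The property is local. Taking ['D_1 phi] as the derivative avoids choosing among the local
    ones. *)
Lemma C1pos_local phi :
  (forall t, exists psi dpsi, C1pos psi dpsi /\ \forall u \near t, phi u = psi u) ->
  exists Q, C1pos phi Q.
Proof.
move=> H; exists (fun t => 'D_1 phi t).
have E t psi dpsi : C1pos psi dpsi -> (\forall u \near t, phi u = psi u) ->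
    is_derive t 1 phi (dpsi t) /\ 'D_1 phi t = dpsi t.
  move=> [d _ _] n.
  have dt : is_derive t 1 phi (dpsi t).
    by apply: near_eq_is_derive (d t); near=> u; apply/esym; near: u.
  by split => //; exact: derive_val.
split=> t; have [psi [dpsi [C n]]] := H t; have [dt Et] := E _ _ _ C n.
- by rewrite Et.
- have [_ dc _] := C; rewrite /continuous_at Et.
  apply: cvg_trans (dc t); apply: near_eq_cvg.
  have := near_join n; apply: filterS => u nu.
  by rewrite (E _ _ _ C nu).2.
- by rewrite Et; case: C.
Unshelve. all: by end_near. Qed.

Section iterates.
Variables (F G dF : R -> R).
Hypotheses (FC : C1pos F dF) (FG : cancel F G) (GF : cancel G F).

(** Integer powers of [F], with [G] as its inverse; [Negz n] is -(n + 1), hence the [n.+1] iterates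
    of [G]. *)
Definition iterz (k : int) : R -> R :=
  match k with Posz n => iter n F | Negz n => iter n.+1 G end.

Lemma iterz_C1pos k : exists d, C1pos (iterz k) d.
Proof.
have GC := C1pos_inv FC FG GF.
have it H dH n : C1pos H dH -> exists d, C1pos (iter n H) d.
  move=> HC; elim: n => [|n [d IH]]; first by eexists; exact: C1pos_id.
  by eexists; exact: C1pos_comp HC IH.
by case: k => n; apply: it; [exact: FC|exact: GC].
Qed.

Lemma iterz_F k x : iterz k (F x) = F (iterz k x).
Proof.
case: k => n /=; first by rewrite -iterSr.
by elim: n => [|n IH] /=; rewrite ?IH ?FG ?GF.
Qed.

Lemma iterzS k x : iterz (k + 1) x = F (iterz k x).
Proof.
case: k => [n|[|n]].
- by rewrite -PoszD addn1.
- by rewrite /= GF.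
- by rewrite (_ : Negz n.+1 + 1 = Negz n) /= ?GF// !NegzE -[n.+2]addn1 PoszD opprD addrNK.
Qed.

Lemma iterz_itv k x : F 0 = 0 -> F 1 = 1 -> 0 < x < 1 -> 0 < iterz k x < 1.
Proof.
move=> F0 F1.
have G0 : G 0 = 0 by rewrite -{1}F0 FG.
have G1 : G 1 = 1 by rewrite -{1}F1 FG.
have it (H : R -> R) dH n : C1pos H dH -> H 0 = 0 -> H 1 = 1 -> 0 < x < 1 ->
    0 < iter n H x < 1.
  move=> HC H0 H1 xI; elim: n => //= n.
  by rewrite -{2}H0 -{2}H1 !(C1pos_lt HC).
move=> xI; case: k => n; first exact: (it F dF).
exact: (it G _ _ (C1pos_inv FC FG GF)).
Qed.

End iterates.

Lemma C1pos_surj F dF : C1pos F dF -> F 0 = 0 -> F 1 = 1 ->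
    (forall x, ~~ (0 < x < 1) -> F x = x) ->
  exists2 G, cancel F G & cancel G F.
Proof.
move=> FC F0 F1 Fout.
have [G GF] : exists G, cancel G F.
  suff /choice[G] : forall y, exists x, F x = y by exists G.
  move=> y; have [yI|/Fout] := boolP (0 < y < 1); last by exists y.
  have [||c _ <-] := @IVT R F 0 1 y ler01; last by exists c.
  - exact/continuous_subspaceT/(C1pos_continuous FC).
  - by rewrite F0 F1 min_l ?max_r// ltW ?ltW//; case/andP: yI.
exists G => // x; apply/le_anti/andP.
by split; rewrite -(C1pos_le FC) GF.
Qed.

(** The seed passes from an affine map [l] to [F \o l1], where [l1] is [l] delayed by one unit.
    Hence [h (t + 1) = F (h t)] on a whole neighbourhood of 0, and the images of the seed under
    powers of [F] join without corners. *)
Lemma orbit_seed F dF G :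
    C1pos F dF -> F 0 = 0 -> F 1 = 1 -> cancel F G -> cancel G F ->
    (forall x, 0 < x < 1 -> x < F x) ->
  exists h dh, [/\ C1pos h dh, forall t, 0 <= t <= 1 -> 0 < h t < 1
    & forall t, - (1 / 3) <= t <= 1 / 3 -> h (t + 1) = F (h t)].
Proof.
move=> FC F0 F1 FG GF Flt; have [Fd Fc Fp] := FC.
have Flt2 : 1 / 2 < F (1 / 2) by apply: Flt; lra.
have F2 : F (1 / 2) < 1 by rewrite -[ltRHS]F1 (C1pos_lt FC); lra.
(* The level [m] separates 1/2 from its image. The slope [k] below is so small that on [0, 1] [l]
   stays under [m] and [F \o l1] above it. *)
pose m := (1 / 2 + F (1 / 2)) / 2.
have m1 : 1 / 2 < m < F (1 / 2) by rewrite /m; apply/andP; split; lra.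
have Gm : G m < 1 / 2 by rewrite -(C1pos_lt FC) GF; lra.
have Gm0 : 0 < G m by rewrite -(C1pos_lt FC) GF F0; lra.
pose k := Num.min (m - 1 / 2) (1 / 2 - G m) / 2.
have k0 : 0 < k by rewrite /k divr_gt0// lt_min; lra.
have km : 1 / 2 + k < m.
  have : Num.min (m - 1 / 2) (1 / 2 - G m) <= m - 1 / 2 by rewrite ge_min lexx.
  by move: k0; rewrite /k; lra.
have kG : G m < 1 / 2 - k.
  have : Num.min (m - 1 / 2) (1 / 2 - G m) <= 1 / 2 - G m.
    by rewrite ge_min lexx orbT.
  by move: k0; rewrite /k; lra.
have [c [dc [cd cc dc0 c01 [cl cr]]]] := smooth_step R.
pose l t := k * t + 1 / 2; pose l1 t := k * t + (1 / 2 - k).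
have l1E t : l1 (t + 1) = l t by rewrite /l1 /l; ring.
have gap t : 0 <= t <= 1 -> [/\ l t <= l 1, l 1 < F (l1 t), 0 < l t & l1 t < 1].
  move=> tI.
  have kt : 0 <= k * t <= k by apply/andP; split; nra.
  have F1m : m < F (l1 t) by rewrite -{1}[m]GF (C1pos_lt FC) /l1; lra.
  by split; rewrite /l /l1 in F1m *; lra.
(* The gap between [l] and [F \o l1] makes the transition from one to the other
   increasing. *)
pose h t := l t + c t * (F (l1 t) - l t).
pose dh t := k + (dc t * (F (l1 t) - l t) + c t * (dF (l1 t) * k - k)).
exists h, dh; split.
- have ld t : is_derive t 1 l k by exact: is_derive1_affine.
  have l1d t : is_derive t 1 l1 k by exact: is_derive1_affine.
  have Fl1d t : is_derive t 1 (fun u => F (l1 u)) (dF (l1 t) * k).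
    exact: is_derive1_comp (Fd _) (l1d t).
  split.
  + move=> t.
    exact: is_derive1D (ld t) (is_derive1M (cd t) (is_derive1B (Fl1d t) (ld t))).
  + have lc := fun t => is_derive_continuous (ld t).
    have l1c := fun t => is_derive_continuous (l1d t).
    have Flc := fun t => is_derive_continuous (Fl1d t).
    have ccc := fun t => is_derive_continuous (cd t).
    move=> t; apply: cvgD; first exact: cvg_cst.
    apply: cvgD; apply: cvgM; [exact: cc| |exact: ccc|].
      by apply: cvgB; [exact: Flc|exact: lc].
    apply: cvgB; last exact: cvg_cst.
    apply: cvgMl; apply: continuous_comp; [exact: l1c|exact: Fc].
  + move=> t; have := Fp (l1 t) => p.
    (* The terms free of [dc] form a convex combination of the positive slopes of [l] and
       [F \o l1]. *)
    have A : 0 < k + c t * (dF (l1 t) * k - k).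
      rewrite (_ : _ + _ = k * (1 - c t) + k * dF (l1 t) * c t); last by ring.
      have := c01 t; have kp : 0 < k * dF (l1 t) by rewrite mulr_gt0.
      have [->|cn0] := eqVneq (c t) 0; first by rewrite mulr0 subr0; lra.
      move=> /andP[c0 c1]; rewrite ltr_wpDl//.
        by rewrite mulr_ge0 ?subr_ge0// ltW.
      by rewrite mulr_gt0// lt_def cn0.
    suff : 0 <= dc t * (F (l1 t) - l t) by rewrite /dh; lra.
    have [tI|] := boolP (0 <= t <= 1).
      by have [? ? _ _] := gap t tI; apply: mulr_ge0 => //; lra.
    rewrite negb_and -!ltNge => /orP[t0|t1].
      by have [|_ ->] := cl t; [lra|rewrite mul0r].
    by have [|_ ->] := cr t; [lra|rewrite mul0r].
- move=> t tI; have [a b d e] := gap t tI; have /andP[c0 c1] := c01 t.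
  have Fl1 : F (l1 t) < 1 by rewrite -[ltRHS]F1 (C1pos_lt FC).
  by rewrite /h; apply/andP; split; nra.
- move=> t tI; rewrite /h l1E.
  have [|-> _] := cr (t + 1); first lra.
  have [|-> _] := cl t; first lra.
  by rewrite mul1r mul0r addr0 addrC subrK.
Qed.

(** The seed is spread over the line by the powers of [F]. The resulting curve reaches both ends
    because a bound inside (0, 1) would be contradicted by [x < F x]. *)
Lemma orbit_param F dF :
    C1pos F dF -> (forall x, ~~ (0 < x < 1) -> F x = x) ->
    (forall x, 0 < x < 1 -> x < F x) ->
  exists phi Q, [/\ C1pos phi Q, forall t, 0 < phi t < 1,
    forall t, phi (t + 1) = F (phi t), forall x, x < 1 -> exists t, x < phi t
    & forall x, 0 < x -> exists t, phi t < x].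
Proof.
move=> FC Fout Flt.
have F0 : F 0 = 0 by apply: Fout; rewrite ltxx.
have F1 : F 1 = 1 by apply: Fout; rewrite ltxx andbF.
have [G FG GF] := C1pos_surj FC F0 F1 Fout.
have [h [dh [hC h01 hS]]] := orbit_seed FC F0 F1 FG GF Flt.
pose phi t := iterz F G (Num.floor t) (h (t - (Num.floor t)%:~R)).
(* The formula of index [k] also holds slightly to the left of [k]; so near every point [phi] is a
   single C^1 composite, integers included. *)
have phiE k t : k%:~R - 1 / 3 < t < k%:~R + 1 -> phi t = iterz F G k (h (t - k%:~R)).
  move=> /andP[tl tr]; have [kt|tk] := leP k%:~R t.
    have E : Num.floor t = k by apply: floor_def; rewrite kt intrD.
    by rewrite /phi E.
  have E : Num.floor t = k - 1.
    by apply: floor_def; rewrite subrK intrB tk andbT; lra.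
  rewrite /phi E -{3}(subrK 1 k) iterzS// -iterz_F//.
  rewrite -hS; last by apply/andP; split; lra.
  by congr (iterz _ _ _ (h _)); rewrite intrB; ring.
have phi01 t : 0 < phi t < 1.
  apply: iterz_itv FC FG GF _ _ F0 F1 _ => //; apply: h01.
  by have := floor_itv t; rewrite intrD; lra.
have phiS t : phi (t + 1) = F (phi t).
  rewrite /phi floorDrz// floor1 iterzS//.
  by congr (F (iterz _ _ _ (h _))); rewrite intrD; ring.
have [Q QC] : exists Q, C1pos phi Q.
  apply: C1pos_local => t; pose k := Num.floor t.
  have [d dC] := iterz_C1pos FC FG GF k.
  have shC : C1pos (fun u => u - k%:~R : R) (cst 1).
    split=> [u|u|u]; [|exact: cst_continuous|exact: ltr01].
    by have := is_derive1B (is_derive_id u 1) (is_derive_cst (k%:~R : R) u 1); rewrite subr0.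
  have := C1pos_comp (C1pos_comp dC hC) shC => C.
  eexists; eexists; split; first exact: C.
  have := floor_itv t; rewrite intrD -/k => tk.
  near=> u; apply: phiE.
  by apply/andP; split; near: u; [apply: lt_nbhsr|apply: lt_nbhsl]; lra.
have phi_lt := C1pos_lt QC.
exists phi, Q; split => // x xI.
(* Otherwise the supremum [l] lies in (0, 1), so [G l < l]; some [phi t] exceeds [G l], and then
   [phi (t + 1)] exceeds [l]. *)
- have [[t xt]|/forallNP H] := pselect (exists t, x < phi t); first by exists t.
  have ubx : ubound (range phi) x.
    by move=> _ [t _ <-]; rewrite leNgt; apply/negP; exact: H.
  have ne : range phi !=set0 by exists (phi 0), 0.
  pose l := sup (range phi).
  have lx : l <= x by apply: ge_sup.
  have lphi t : phi t <= l by apply: ub_le_sup; [exists x|exists t].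
  have l01 : 0 < l < 1 by have := phi01 0; have := lphi 0; lra.
  have Gl : G l < l by rewrite -(C1pos_lt FC) GF; exact: Flt.
  have [_ [t _ <-] Gt] := sup_gt ne Gl.
  have := lphi (t + 1); rewrite phiS -{1}[l]GF leNgt.
  by rewrite (C1pos_lt FC) Gt.
- have [[t xt]|/forallNP H] := pselect (exists t, phi t < x); first by exists t.
  have lbx : lbound (range phi) x.
    by move=> _ [t _ <-]; rewrite leNgt; apply/negP; exact: H.
  have ne : range phi !=set0 by exists (phi 0), 0.
  pose l := inf (range phi).
  have lx : x <= l by apply: lb_le_inf.
  have lphi t : l <= phi t by apply: ge_inf; [exists x|exists t].
  have l01 : 0 < l < 1 by have := phi01 0; have := lphi 0; lra.
  have [_ [t _ <-] Ft] := inf_lt ne (Flt _ l01).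
  have := lphi (t - 1); rewrite leNgt -(C1pos_lt FC) -phiS subrK.
  by rewrite Ft.
Unshelve. all: by end_near. Qed.

End orbit_parametrization.

(** * Perturbation of the interpolated orbit *)

Section within_factor.
Variable R : realType.
Implicit Types l x y : R.

(** For positive numbers: the ratio lies between 1/l and l. This multiplicative closeness passes to
    sums, products and inverses. *)
Definition within_factor l x y : bool := (x <= l * y) && (y <= l * x).

Lemma factor_le l l' x y : l <= l' -> 0 <= x -> 0 <= y ->
  within_factor l x y -> within_factor l' x y.
Proof.
by move=> ll x0 y0 /andP[a b]; apply/andP; split; [apply: (le_trans a)|apply: (le_trans b)];
  rewrite ler_wpM2r.
Qed.

Lemma factorD l x y x' y' : within_factor l x y -> within_factor l x' y' ->
  within_factor l (x + x') (y + y').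
Proof.
by move=> /andP[? ?] /andP[? ?]; apply/andP; split; rewrite mulrDr lerD.
Qed.

Lemma factorM l l' x y x' y' : 0 <= x -> 0 <= y -> 0 <= x' -> 0 <= y' ->
  within_factor l x y -> within_factor l' x' y' -> within_factor (l * l') (x * x') (y * y').
Proof.
move=> x0 y0 x'0 y'0 /andP[? ?] /andP[? ?].
by apply/andP; split; rewrite mulrACA ler_pM.
Qed.

Lemma factorZ l c x y : 0 <= c -> within_factor l x y -> within_factor l (c * x) (c * y).
Proof.
by move=> c0 /andP[? ?]; apply/andP; split; rewrite mulrCA ler_wpM2l.
Qed.

Lemma factorV l x y : 0 < x -> 0 < y -> within_factor l x y -> within_factor l x^-1 y^-1.
Proof.
move=> x0 y0 /andP[a b]; apply/andP; split.
  by rewrite ler_pdivlMr// mulrC ler_pdivrMr.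
by rewrite ler_pdivlMr// mulrC ler_pdivrMr.
Qed.

(** The ratio is at most l and at least 1/l, and 1/l >= 2 - l. *)
Lemma factor_ratio l x y : 0 < x -> 0 < y -> within_factor l x y -> `|y / x - 1| <= l - 1.
Proof.
move=> x0 y0 /andP[a b].
have l1 : 1 <= l.
  have l0 : 0 < l by rewrite -(pmulr_lgt0 _ y0); exact: lt_le_trans a.
  have : y <= l * l * y by rewrite -mulrA; apply: (le_trans b); rewrite ler_pM2l.
  rewrite -[leLHS]mul1r ler_pM2r//; nra.
have : y / x <= l by rewrite ler_pdivrMr.
have : 1 <= l * (y / x) by rewrite mulrA ler_pdivlMr// mul1r.
have : 0 < y / x by rewrite divr_gt0.
by move: (y / x) => z ? ? ?; rewrite ler_norml; apply/andP; split; nra.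
Qed.

End within_factor.

(** A tube lemma: by joint continuity the strict bound persists around each [(t, 0)], and
    compactness of the segment makes the range of [x] uniform. *)
Lemma compact_near_param (R : realType) (P : R -> R -> R) (a b e : R) :
    (forall t, a <= t <= b -> {for (t, 0), continuous (fun z => P z.2 z.1)}) ->
    (forall t, a <= t <= b -> `|P 0 t| < e) ->
  \forall x \near (0 : R), forall t, a <= t <= b -> `|P x t| < e.
Proof.
move=> Pc P0.
have /compact_near_coveringP := @segment_compact R a b.
move=> /(_ R (nbhs (0 : R)) (fun x t => `|P x t| < e) _) H.
have : \forall x \near (0 : R), `[a, b]%classic `<=` (fun t => `|P x t| < e).
  apply: H => t /=; rewrite in_itv/= => tI.
  have /= c : `|P z.2 z.1| @[z --> (t, 0 : R)] --> `|P 0 t| by exact: cvg_norm (Pc t tI).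
  have : \forall z \near (t, 0 : R), `|P z.2 z.1| < e.
    exact: (c [set y | y < e] (lt_nbhsl (P0 t tI))).
  by [].
by apply: filterS => x H' t tI; apply: H'; rewrite /= in_itv.
Qed.

Section perturbation.
Variables (R : realType) (phi Q : R -> R) (k : R).
Hypotheses (phiC : C1pos phi Q) (phi01 : forall t, 0 < phi t < 1) (k0 : 0 < k).
Implicit Types (eta t : R).

Let ep (a t : R) : R := expR (a * t).

(** The quotient [numer / denom] is the average of [phi t], 1 and 0 with weights 1, [eta * ep k t]
    and [eta * ep (- k) t]; [conumer] is the analogue of [numer] for [1 - phi]. *)
Definition numer eta t : R := phi t + eta * ep k t.
Definition conumer eta t : R := 1 - phi t + eta * ep (- k) t.
Definition denom eta t : R := 1 + eta * (ep k t + ep (- k) t).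
(* [numer' * denom - numer * denom'] *)
Definition wronskian eta t : R :=
  Q t * denom eta t
  + k * eta * (ep k t * conumer eta t + ep (- k) t * numer eta t).
Definition damped_speed eta t : R := wronskian eta t / denom eta t ^+ 2.
Definition atan_speed t : R := (1 + t ^+ 2)^-1 / pi.

(* Where [eta * expR (k * `|t|)] is small, the first term follows [phi]; its speed
   decays exponentially at infinity, where the second term takes over. *)
Definition psi eta t : R :=
  (1 - eta) * (numer eta t / denom eta t) + eta * (1 / 2 + atan t / pi).
Definition speed eta t : R :=
  (1 - eta) * damped_speed eta t + eta * atan_speed t.

Let ep_gt0 a t : 0 < ep a t. Proof. exact: expR_gt0. Qed.

Lemma denomE eta t : denom eta t = numer eta t + conumer eta t.
Proof. by rewrite /denom /numer /conumer; ring. Qed.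

Lemma denom_ge1 eta t : 0 <= eta -> 1 <= denom eta t.
Proof. by move=> e0; rewrite /denom lerDl mulr_ge0// addr_ge0// ltW. Qed.

Lemma denom_gt0 eta t : 0 <= eta -> 0 < denom eta t.
Proof. by move=> /denom_ge1-/(_ t); apply: lt_le_trans. Qed.

Lemma numer_gt0 eta t : 0 <= eta -> 0 < numer eta t.
Proof.
move=> e0; have /andP[p0 _] := phi01 t.
by rewrite /numer ltr_wpDr// mulr_ge0// ltW.
Qed.

Lemma conumer_gt0 eta t : 0 <= eta -> 0 < conumer eta t.
Proof.
move=> e0; have /andP[_ p1] := phi01 t.
by rewrite /conumer ltr_wpDr ?subr_gt0// mulr_ge0// ltW.
Qed.

Lemma wronskian_gt0 eta t : 0 <= eta -> 0 < wronskian eta t.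
Proof.
move=> e0; have [_ _ /(_ t) Q0] := phiC.
rewrite /wronskian ltr_wpDr ?mulr_gt0 ?denom_gt0//.
by rewrite mulr_ge0 ?(mulr_ge0 (ltW k0) e0)// ltW// addr_gt0// mulr_gt0//
  ?numer_gt0 ?conumer_gt0.
Qed.

Lemma damped_speed_gt0 eta t : 0 <= eta -> 0 < damped_speed eta t.
Proof. by move=> e0; rewrite divr_gt0 ?wronskian_gt0// exprn_gt0// denom_gt0. Qed.

Lemma atan_speed_gt0 t : 0 < atan_speed t.
Proof. by rewrite divr_gt0 ?pi_gt0// invr_gt0 ltr_pwDl// sqr_ge0. Qed.

Lemma speed_gt0 eta t : 0 <= eta < 1 -> 0 < speed eta t.
Proof.
move=> /andP[e0 e1]; rewrite ltr_wpDr//.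
  by rewrite mulr_ge0// ltW// atan_speed_gt0.
by rewrite mulr_gt0 ?damped_speed_gt0// subr_gt0.
Qed.

Lemma psi_itv eta t : 0 <= eta < 1 -> 0 < psi eta t < 1.
Proof.
move=> /andP[e0 e1].
have D0 := denom_gt0 t e0.
have x01 : 0 < numer eta t / denom eta t < 1.
  rewrite divr_gt0 ?numer_gt0//= ltr_pdivrMr// mul1r denomE.
  by rewrite ltrDl conumer_gt0.
have y01 : 0 < 1 / 2 + atan t / pi < 1.
  have := atan_gtNpi2 t; have := atan_ltpi2 t; have := pi_gt0 R => p0 a b.
  have : - (1 / 2) < atan t / pi < 1 / 2.
    by rewrite ltr_pdivrMr// ltr_pdivlMr//; apply/andP; split; lra.
  by move=> ?; lra.
rewrite /psi; move: (_ / _) (1 / 2 + _) x01 y01 => x y.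
by move=> /andP[? ?] /andP[? ?]; apply/andP; split; nra.
Qed.

Let is_derive_ep a t : is_derive t 1 (ep a) (a * ep a t).
Proof.
have d := @is_derive1_comp R expR (fun u => a * u) t _ _
  (is_derive_expR (a * t)) (is_derive1Z a (is_derive_id t 1)).
by apply: is_derive_eq d _; rewrite mulr1 mulrC.
Qed.

Lemma is_derive_psi eta t : 0 <= eta -> is_derive t 1 (psi eta) (speed eta t).
Proof.
move=> e0; have D0 : denom eta t != 0 by rewrite gt_eqF// denom_gt0.
have [phid _ _] := phiC.
have dn : is_derive t 1 (numer eta) (Q t + eta * (k * ep k t)).
  exact: is_derive1D (phid t) (is_derive1Z eta (is_derive_ep k t)).
have dd : is_derive t 1 (denom eta) (0 + eta * (k * ep k t + - k * ep (- k) t)).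
  exact: is_derive1D (is_derive_cst (1 : R) t 1)
    (is_derive1Z eta (is_derive1D (is_derive_ep k t) (is_derive_ep (- k) t))).
have da := is_derive1D (is_derive_cst (1 / 2 : R) t 1)
  (is_derive1Z pi^-1 (is_derive1_atan t)).
have d := is_derive1D (is_derive1Z (1 - eta) (is_derive1M dn (is_derive1V D0 dd)))
  (is_derive1Z eta da).
have -> : psi eta = (fun u => (1 - eta) * (numer eta u * (denom eta u)^-1)
    + eta * (1 / 2 + pi^-1 * atan u)).
  by apply/funext => u; rewrite /psi (mulrC (pi^-1)).
apply: is_derive_eq d _.
rewrite /speed /damped_speed /atan_speed /wronskian; congr (_ * _ + _ * _).
  (* With this substitution the quotient rule yields [wronskian], whose terms are all
     nonnegative. *)
  have -> : conumer eta t = denom eta t - numer eta t by rewrite denomE; ring.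
  by move: (denom eta t) (numer eta t) D0 => D A D0; field.
by rewrite add0r mulrC.
Qed.

Let continuous_fst2 (f : R -> R) (z : R * R) :
  {for z.1, continuous f} -> {for z, continuous (fun w : R * R => f w.1)}.
Proof. by move=> fc; exact: (@continuous_comp (R * R)%type R R fst f z cvg_fst fc). Qed.

Let continuous_snd2 (z : R * R) : {for z, continuous (fun w : R * R => w.2)}.
Proof. exact: cvg_snd. Qed.

Let continuous_ep a : continuous (ep a).
Proof. by move=> t; exact: is_derive_continuous (is_derive_ep a t). Qed.

Let continuous_ep2 a (z : R * R) : {for z, continuous (fun w : R * R => ep a w.1)}.
Proof. exact/continuous_fst2/continuous_ep. Qed.

Let continuous_phi2 (z : R * R) : {for z, continuous (fun w : R * R => phi w.1)}.
Proof. exact/continuous_fst2/(C1pos_continuous phiC). Qed.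

Let continuous_numer (z : R * R) :
  {for z, continuous (fun w : R * R => numer w.2 w.1)}.
Proof.
apply: cvgD; first exact: continuous_phi2.
by apply: cvgM; [exact: continuous_snd2|exact: continuous_ep2].
Qed.

Let continuous_conumer (z : R * R) :
  {for z, continuous (fun w : R * R => conumer w.2 w.1)}.
Proof.
apply: cvgD; first by apply: cvgB; [exact: cvg_cst|exact: continuous_phi2].
by apply: cvgM; [exact: continuous_snd2|exact: continuous_ep2].
Qed.

Let continuous_denom (z : R * R) :
  {for z, continuous (fun w : R * R => denom w.2 w.1)}.
Proof.
apply: cvgD; first exact: cvg_cst.
apply: cvgM; first exact: continuous_snd2.
by apply: cvgD; exact: continuous_ep2.
Qed.

Let continuous_atan_speed : continuous atan_speed.
Proof.
move=> t; apply: cvgMl; apply: cvgV.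
  by rewrite gt_eqF// ltr_pwDl// sqr_ge0.
by apply: cvgD; [exact: cvg_cst|apply: cvgM; exact: cvg_id].
Qed.

(** Continuity in the pair is what [compact_near_param] needs in order to let [eta] tend to 0. *)
Lemma continuous_psi2 eta t : 0 <= eta ->
  {for (t, eta), continuous (fun z : R * R => psi z.2 z.1)}.
Proof.
move=> e0; apply: cvgD; apply: cvgM.
- by apply: cvgB; [exact: cvg_cst|exact: continuous_snd2].
- apply: cvgM; first exact: continuous_numer.
  by apply: cvgV; [rewrite gt_eqF// denom_gt0|exact: continuous_denom].
- exact: continuous_snd2.
- apply: cvgD; first exact: cvg_cst.
  apply: cvgMl; apply: (@continuous_fst2 atan); exact: continuous_atan.
Qed.

Lemma continuous_speed2 eta t : 0 <= eta ->
  {for (t, eta), continuous (fun z : R * R => speed z.2 z.1)}.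
Proof.
move=> e0; have [_ Qc _] := phiC; apply: cvgD; apply: cvgM.
- by apply: cvgB; [exact: cvg_cst|exact: continuous_snd2].
- apply: cvgM; last first.
    apply: cvgV; first by rewrite gt_eqF// exprn_gt0// denom_gt0.
    by apply: cvgM; exact: continuous_denom.
  apply: cvgD; first by apply: cvgM; [exact/continuous_fst2/Qc|exact: continuous_denom].
  apply: cvgM; first by apply: cvgMr; exact: continuous_snd2.
  by apply: cvgD; apply: cvgM; [exact: continuous_ep2|exact: continuous_conumer
    |exact: continuous_ep2|exact: continuous_numer].
- exact: continuous_snd2.
- exact/continuous_fst2/continuous_atan_speed.
Qed.

Lemma psi_C1pos eta : 0 <= eta < 1 -> C1pos (psi eta) (speed eta).
Proof.
move=> eI; have /andP[e0 _] := eI; split=> t.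
- exact: is_derive_psi.
- apply: (@continuous_comp _ _ _ (fun t => (t, eta)) (fun z : R * R => speed z.2 z.1)).
    apply: (@cvg_pair R R R (nbhs t) (nbhs t) (nbhs eta) _ _ _ id (cst eta)).
      exact: cvg_id.
    exact: cvg_cst.
  exact: continuous_speed2.
- exact: speed_gt0.
Qed.

Lemma psi0 t : psi 0 t = phi t.
Proof. by rewrite /psi /numer /denom !mul0r !addr0 subr0 divr1 mul1r. Qed.

Lemma speed0 t : speed 0 t = Q t.
Proof.
rewrite /speed /damped_speed /wronskian /denom !mul0r mulr0 mul0r !addr0.
by rewrite subr0 expr1n divr1 mul1r mulr1.
Qed.

(** Every ingredient changes by a factor at most [expR k] over a unit of time. The wronskian, a sum
    of products of two ingredients, costs two such factors, and the squared denominator two more: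
    hence the fourth power. *)
Lemma factor_speed eta t : 0 <= eta < 1 ->
    within_factor (expR k) (Q t) (Q (t + 1)) ->
    within_factor (expR k) (phi t) (phi (t + 1)) ->
    within_factor (expR k) (1 - phi t) (1 - phi (t + 1)) ->
    within_factor (expR k) (atan_speed t) (atan_speed (t + 1)) ->
  within_factor (expR k ^+ 4) (speed eta t) (speed eta (t + 1)).
Proof.
move=> /andP[e0 e1] HQ Hp Hcp Ha.
set l := expR k.
have l1 : 1 <= l by rewrite -[leLHS](@expR0 R) ler_expR ltW.
have ll n : l <= l ^+ n.+1 by rewrite exprS ler_peMr ?exprn_ege1// ltW// expR_gt0.
have epS : ep k (t + 1) = l * ep k t by rewrite /ep mulrDr mulr1 expRD mulrC.
have emS : ep (- k) t = l * ep (- k) (t + 1).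
  by rewrite /ep mulrDr mulr1 expRD mulrCA expRxMexpNx_1 mulr1.
have ge0 a u : 0 <= ep a u by exact: ltW.
have l0 : 0 < l by exact: expR_gt0.
have Hk : within_factor l (ep k t) (ep k (t + 1)).
  by rewrite /within_factor epS lexx andbT mulrA ler_peMl//; nra.
have Hmk : within_factor l (ep (- k) t) (ep (- k) (t + 1)).
  by rewrite /within_factor emS lexx/= mulrA ler_peMl//; nra.
have ngt0 := numer_gt0 _ e0; have cgt0 := conumer_gt0 _ e0.
have dgt0 := denom_gt0 _ e0; have wgt0 := wronskian_gt0 _ e0.
have [_ _ Q0] := phiC.
have Hn : within_factor l (numer eta t) (numer eta (t + 1)).
  by apply: factorD => //; exact: factorZ.
have Hc : within_factor l (conumer eta t) (conumer eta (t + 1)).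
  by apply: factorD => //; exact: factorZ.
have Hd : within_factor l (denom eta t) (denom eta (t + 1)).
  by rewrite !denomE; exact: factorD.
have Hw : within_factor (l * l) (wronskian eta t) (wronskian eta (t + 1)).
  apply: factorD; first by apply: factorM => //; exact: ltW.
  apply: factorZ; first by rewrite mulr_ge0// ltW.
  by apply: factorD; apply: factorM => //; exact: ltW.
apply: factorD; apply: factorZ => //; first by rewrite subr_ge0 ltW.
  rewrite (_ : l ^+ 4 = l * l * (l * l)); last by ring.
  have dd u : 0 < denom eta u ^+ 2 by rewrite exprn_gt0.
  have Hdd : within_factor (l * l) (denom eta t ^+ 2) (denom eta (t + 1) ^+ 2).
    by rewrite !expr2; apply: factorM => //; exact: ltW.
  have Hdv := factorV (dd t) (dd (t + 1)) Hdd.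
  by apply: factorM Hw Hdv; rewrite ?invr_ge0; exact: ltW.
apply: factor_le Ha; first exact: (ll 3%N).
  exact/ltW/atan_speed_gt0.
exact/ltW/atan_speed_gt0.
Qed.

End perturbation.

(** * Behaviour of the perturbed speed at infinity *)

Section tails.
Variables (R : realType).
Implicit Types (phi Q u : R -> R) (c e k m s t eta : R).

(** Beyond [m] the function [u t * expR (- c * t)] does not increase over unit steps, so its maximum
    on [0, m + 1] bounds it on the half-line. *)
Lemma subexponential u c m : continuous u -> 0 <= m ->
    (forall t, m <= t -> u (t + 1) <= expR c * u t) ->
  exists C, forall t, 0 <= t -> u t <= C * expR (c * t).
Proof.
move=> uc m0 uS; pose w t := u t * expR (- c * t).
have wE t : u t = w t * expR (c * t).
  by rewrite /w mulNr expRN divfK// gt_eqF// expR_gt0.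
have wS t : m <= t -> w (t + 1) <= w t.
  move=> mt; rewrite /w mulrDr mulr1 expRD mulrCA [leRHS]mulrC.
  by rewrite ler_pM2l ?expR_gt0// expRN ler_pdivrMr ?expR_gt0// mulrC; exact: uS.
have wc : continuous w.
  move=> t; apply: cvgM; first exact: uc.
  apply: (@continuous_comp _ _ _ (fun t => - c * t) expR).
    by apply: cvgMr; exact: cvg_id.
  exact: continuous_expR.
have m1 : 0 <= m + 1 by rewrite addr_ge0.
have [x _ wx] := EVT_max m1 (continuous_subspaceT wc).
exists (w x) => t t0; rewrite wE ler_pM2r ?expR_gt0//.
have [n] : exists n : nat, t <= m + 1 + n%:R.
  exists (Num.truncn t).+1; have := truncnS_gt t; rewrite -natr1.
  by move: m1; lra.
elim: n t t0 => [|n IH] t t0.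
  by rewrite addr0 => tm; apply: wx; rewrite in_itv/= t0.
move=> tn; have [tm|mt] := leP t (m + 1); first by apply: wx; rewrite in_itv/= t0.
rewrite -(subrK 1 t); apply: (le_trans (wS _ _)); first by rewrite lerBrDr ltW.
by apply: IH; [lra|move: tn; rewrite -natr1; lra].
Qed.

Lemma atan_speed_tail e : 0 < e -> exists2 T, 0 <= T &
  forall t s, T < `|t| -> 0 <= s <= 1 ->
    within_factor (1 + e) (atan_speed t) (atan_speed (t + s)).
Proof.
(* If |a| is at least 1 and 3/e, then (|a| + 1)^2 <= a^2 + 3|a| <= (1 + e) a^2. One more unit is
   spent on comparing [|t + s|] with [|t|]. *)
move=> e0; exists (3 / e + 2); first by rewrite addr_ge0// divr_ge0// ltW.
move=> t s tT /andP[s0 s1].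
have key a b : 3 / e + 1 < `|a| -> `|b - a| <= 1 -> b ^+ 2 <= a ^+ 2 + e * a ^+ 2.
  move=> Ta ba.
  have a1 : 1 <= `|a| by rewrite ltW// (le_lt_trans _ Ta)// lerDr divr_ge0// ltW.
  have ea : 3 <= e * `|a| by rewrite -ler_pdivrMl// mulrC; lra.
  have b2 : `|b| <= `|a| + 1 by have := ler_normD (b - a) a; rewrite subrK; lra.
  rewrite -(real_normK (num_real a)) -(real_normK (num_real b)).
  have := normr_ge0 b; move: `|a| `|b| a1 ea b2 => x y; nra.
have tp x : 0 < 1 + x ^+ 2 :> R by rewrite ltr_pwDl// sqr_ge0.
have /andP[a b] : within_factor (1 + e) (1 + t ^+ 2) (1 + (t + s) ^+ 2).
  apply/andP; split.
    suff : t ^+ 2 <= (t + s) ^+ 2 + e * (t + s) ^+ 2 by move=> ?; nra.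
    apply: key; last by rewrite opprD addNKr normrN ger0_norm.
    have := ler_normD (t + s) (- s); rewrite addrK normrN (ger0_norm s0).
    by lra.
  suff : (t + s) ^+ 2 <= t ^+ 2 + e * t ^+ 2 by move=> ?; nra.
  by apply: key; [lra|rewrite addrAC subrr add0r ger0_norm].
rewrite /atan_speed ![_^-1 / pi]mulrC; apply: factorZ.
  by rewrite invr_ge0 pi_ge0.
by apply: factorV => //; apply/andP.
Qed.

Variables (phi Q : R -> R) (k : R).
Hypotheses (phiC : C1pos phi Q) (phi01 : forall t, 0 < phi t < 1) (k0 : 0 < k).

Local Notation denom := (denom k).
Local Notation damped_speed := (damped_speed phi Q k).
Local Notation speed := (speed phi Q k).

(** The two exponentials have product 1, so each of the two products in [wronskian], times [eta], is
    at most [denom]; this cancels one factor of the squared denominator. *)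
Lemma damped_speed_le eta t : 0 <= eta <= 1 ->
  damped_speed eta t <= (Q t + 2 * k) / denom eta t.
Proof.
move=> /andP[e0 e1].
have D0 := denom_gt0 k t e0.
rewrite /damped_speed expr2 invfM mulrA ler_pM2r ?invr_gt0//.
rewrite ler_pdivrMr// /wronskian mulrDl lerD2l.
rewrite (_ : 2 * k * _ = k * (denom eta t + denom eta t)); last by ring.
rewrite -mulrA ler_pM2l// mulrDr.
have ee : expR (k * t) * expR (- k * t) = 1 by rewrite mulNr expRxMexpNx_1.
have a0 := expR_gt0 (k * t); have b0 := expR_gt0 (- k * t).
have /andP[p0 p1] := phi01 t.
rewrite /conumer /numer /denom.
move: (expR (k * t)) (expR (- k * t)) ee a0 b0 => a b ee a0 b0.
apply: lerD.
- have -> : eta * (a * (1 - phi t + eta * b)) = eta * a * (1 - phi t) + eta * eta * (a * b) by ring.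
  have : 0 <= eta * a by rewrite mulr_ge0// ltW.
  have : 0 <= eta * b by rewrite mulr_ge0// ltW.
  by rewrite ee; nra.
- have -> : eta * (b * (phi t + eta * a)) = eta * b * phi t + eta * eta * (a * b) by ring.
  have : 0 <= eta * a by rewrite mulr_ge0// ltW.
  have : 0 <= eta * b by rewrite mulr_ge0// ltW.
  by rewrite ee; nra.
Qed.

Lemma denom_ge eta t : 0 <= eta -> eta * expR (k * `|t|) <= denom eta t.
Proof.
move=> e0; rewrite /denom.
have a0 := expR_gt0 (k * t); have b0 := expR_gt0 (- k * t).
rewrite -[leLHS]add0r lerD// ler_wpM2l//.
by case: (ger0P t) => _; rewrite ?mulrN -?mulNr ?lerDl ?lerDr ltW.
Qed.

(** The numerator grows at most like e^(k|t|/2) and the denominator at least like e^(k|t|). The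
    quotient thus decays exponentially, whereas [atan_speed] decays only like 1/t^2. *)
Lemma damped_speed_tail eta C e : 0 < eta <= 1 -> 0 < e ->
    (forall t, Q t <= C * expR (k / 2 * `|t|)) ->
  exists T, forall t, T < `|t| -> damped_speed eta t <= e * atan_speed t.
Proof.
move=> /andP[e0 e1] ep QC.
have [_ _ Q0] := phiC.
have C0 : 0 < C by have := Q0 0; move/lt_le_trans/(_ (QC 0)); rewrite pmulr_lgt0// expR_gt0.
pose K := C + 2 * k; have K0 : 0 < K by rewrite addr_gt0// mulr_gt0.
pose M := e * eta * (k / 2) ^+ 3.
have M0 : 0 < M by rewrite !mulr_gt0// exprn_gt0// divr_gt0.
have pi0 := pi_gt0 R.
(* The exponential is bounded below by its cubic Taylor term. For this [|t|], M|t|^3 / 6 exceeds 2 K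
   pi t^2, which is at least K pi (1 + t^2). *)
exists (Num.max 1 (12 * K * pi / M)) => t; rewrite gt_max => /andP[t1].
rewrite ltr_pdivrMr// => tM.
have := @expR_ge1Dxn R (k / 2 * `|t|) 2 (mulr_ge0 (ltW (divr_gt0 k0 (ltr0n _ 2))) (normr_ge0 _)).
rewrite (_ : 3`!%:R = 6)// => /(le_trans (_ : _ <= _)) x6.
have {x6} : (k / 2 * `|t|) ^+ 3 / 6 <= expR (k / 2 * `|t|) by apply: x6; rewrite lerDr.
have xx : expR (k * `|t|) = expR (k / 2 * `|t|) * expR (k / 2 * `|t|).
  by rewrite -expRD; congr expR; field.
have x1 : 1 <= expR (k / 2 * `|t|).
  by rewrite -[leLHS](@expR0 R) ler_expR mulr_ge0// divr_ge0// ltW.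
have eI : 0 <= eta <= 1 by rewrite ltW.
have := damped_speed_le t eI; have := denom_ge t (ltW e0).
have := QC t; rewrite xx; move: (expR _) x1 => x x1 Qx Dx dQ xt.
have x0 : 0 < x by exact: lt_le_trans x1.
apply: (le_trans dQ).
have Qk : Q t + 2 * k <= K * x.
  have : 2 * k <= 2 * k * x by rewrite ler_peMr// mulr_ge0// ltW.
  by rewrite /K; lra.
rewrite ler_pdivrMr; last by apply: lt_le_trans Dx; rewrite !mulr_gt0.
apply: (le_trans Qk).
have tp : 0 < 1 + `|t| ^+ 2 :> R by rewrite ltr_pwDl// sqr_ge0.
have at0 : 0 < e * atan_speed t by rewrite mulr_gt0// atan_speed_gt0.
apply: (@le_trans _ _ (e * atan_speed t * (eta * (x * x)))); last by rewrite ler_pM2l.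
rewrite [leRHS](_ : _ = e * eta * atan_speed t * x * x); last by ring.
rewrite ler_pM2r// /atan_speed -(real_normK (num_real t)).
rewrite [leRHS](_ : _ = e * eta * x / ((1 + `|t| ^+ 2) * pi)); last first.
  by rewrite invfM; ring.
rewrite ler_pdivlMr; last by rewrite mulr_gt0.
move: xt tM t1; rewrite /M; move: `|t| => y xt tM y1.
have : e * eta * ((k / 2 * y) ^+ 3 / 6) <= e * eta * x by rewrite ler_pM2l// mulr_gt0.
apply: le_trans.
have -> : e * eta * ((k / 2 * y) ^+ 3 / 6) = y * (e * eta * (k / 2) ^+ 3) * y ^+ 2 / 6 by field.
have : 12 * K * pi * y ^+ 2 <= y * (e * eta * (k / 2) ^+ 3) * y ^+ 2.
  by rewrite ler_wpM2r ?sqr_ge0// ltW.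
have : K * ((1 + y ^+ 2) * pi) <= 12 * K * pi * y ^+ 2 / 6.
  have -> : 12 * K * pi * y ^+ 2 / 6 = K * ((2 * y ^+ 2) * pi) by field.
  by rewrite ler_pM2l// ler_pM2r//; nra.
by lra.
Qed.

(** Far out, [speed] lies between its arctangent part and [1 + d] times that part, which itself
    varies by a factor at most [1 + d]. *)
Lemma speed_tail eta C e : 0 < eta < 1 -> 0 < e ->
    (forall t, Q t <= C * expR (k / 2 * `|t|)) ->
  exists T, forall t s, T < `|t| -> 0 <= s <= 1 ->
    within_factor (1 + e) (speed eta t) (speed eta (t + s)).
Proof.
move=> /andP[e0 e1] ep QC.
(* Since d <= 1, (1 + d)^2 <= 1 + 3d <= 1 + e. *)
pose d := Num.min 1 (e / 3).
have d0 : 0 < d by rewrite lt_min ltr01 divr_gt0.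
have de : (1 + d) * (1 + d) <= 1 + e.
  have : d <= 1 by rewrite ge_min lexx.
  have : d <= e / 3 by rewrite ge_min lexx orbT.
  by move: d0; nra.
have [T1 T10 H1] := atan_speed_tail d0.
have [||T2 H2] := @damped_speed_tail eta C (eta * d) _ _ QC.
- by rewrite e0 ltW.
- by rewrite mulr_gt0.
exists (Num.max T1 T2 + 1) => t s tT sI.
have sI2 := sI; case/andP: sI2 => s0 s1.
have T1m : T1 <= Num.max T1 T2 by rewrite le_max lexx.
have T2m : T2 <= Num.max T1 T2 by rewrite le_max lexx orbT.
have tsT : Num.max T1 T2 < `|t + s|.
  by have := ler_normD (t + s) (- s); rewrite addrK normrN (ger0_norm s0); lra.
have sp x : T2 < `|x| -> eta * atan_speed x <= speed eta x <= (1 + d) * (eta * atan_speed x).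
  move=> /H2 h; rewrite /speed lerDr mulr_ge0 ?subr_ge0 ?(ltW e1)//=; last first.
    by apply/ltW/damped_speed_gt0 => //; exact: ltW.
  have := damped_speed_gt0 phiC phi01 k0 x (ltW e0).
  by move: (damped_speed _ _) h => p h p0; nra.
have /andP[a1 a2] : within_factor (1 + d) (eta * atan_speed t) (eta * atan_speed (t + s)).
  by apply: factorZ; [exact: ltW|apply: H1 => //; lra].
have /andP[b1 b2] : eta * atan_speed t <= speed eta t <= (1 + d) * (eta * atan_speed t).
  by apply: sp; lra.
have /andP[c1 c2] := sp (t + s) (le_lt_trans T2m tsT).
have q0 x : 0 < speed eta x by apply: speed_gt0 => //; rewrite ltW.
apply: (factor_le de); [exact/ltW/q0|exact/ltW/q0|].
have d1 : 0 <= 1 + d by rewrite addr_ge0// ltW.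
rewrite /within_factor -!mulrA; apply/andP; split.
  apply: (le_trans b2); rewrite ler_wpM2l//; apply: (le_trans a1).
  by rewrite ler_wpM2l.
apply: (le_trans c2); rewrite ler_wpM2l//; apply: (le_trans a2).
by rewrite ler_wpM2l.
Qed.

End tails.

(** * Conjugated shifts *)

Section conjugated_shift.
Variable R : realType.

Lemma C1pos_onto_unit (psi q : R -> R) : C1pos psi q ->
    (forall e, 0 < e -> exists t, 1 - psi t < e /\ psi (- t) < e) ->
  forall x, 0 < x < 1 -> exists t, psi t = x.
Proof.
move=> psiC psiT x /andP[x0 x1].
have [t1 [_ a]] := psiT _ x0.
have [|t2 [b _]] := psiT (1 - x); first by rewrite subr_gt0.
have lt : - t1 <= t2.
  by rewrite -(C1pos_le psiC); apply/ltW/(lt_trans a); move: b; lra.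
have [||c _ <-] := @IVT R psi (- t1) t2 x lt; last by exists c.
- exact/continuous_subspaceT/(C1pos_continuous psiC).
- rewrite min_l ?max_r ?(C1pos_le psiC)//.
  by rewrite ltW//=; move: b; lra.
Qed.

(** On (0, 1), [G] is the shift by [s] conjugated by [psi], with derivative [q (t + s) / q t] at
    [psi t]. The last hypothesis says that this tends to 1 at both ends, so the extension by the
    identity is C^1. *)
Lemma conj_shift (psi q : R -> R) (s : R) :
    C1pos psi q -> (forall t, 0 < psi t < 1) ->
    (forall e, 0 < e -> exists t, 1 - psi t < e /\ psi (- t) < e) ->
    0 <= s ->
    (forall e, 0 < e ->
       exists T, forall t, T < `|t| -> `|q (t + s) / q t - 1| <= e) ->
  exists G dG, [/\ C1pos G dG, forall t, G (psi t) = psi (t + s),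
    forall t, dG (psi t) = q (t + s) / q t,
    forall x, ~~ (0 < x < 1) -> G x = x & forall x, ~~ (0 < x < 1) -> dG x = 1].
Proof.
move=> psiC psi01 psiT s0 qT; have [psid qc q0] := psiC.
have lt_psi := C1pos_lt psiC.
have [i iP] : exists i : R -> R, forall x, 0 < x < 1 -> psi (i x) = x.
  suff /choice[i iP] : forall x, exists t, 0 < x < 1 -> psi t = x by exists i.
  move=> x; have [xI|xI] := boolP (0 < x < 1); last by exists 0.
  by have [t tx] := C1pos_onto_unit psiC psiT xI; exists t.
have iK t : i (psi t) = t.
  by apply/le_anti/andP; split; rewrite -(C1pos_le psiC) iP.
pose G x := if 0 < x < 1 then psi (i x + s) else x.
pose dG x := if 0 < x < 1 then q (i x + s) / q (i x) else 1.
have Gpsi t : G (psi t) = psi (t + s) by rewrite /G psi01 iK.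
have dGpsi t : dG (psi t) = q (t + s) / q t by rewrite /dG psi01 iK.
have Gout (x : R) : ~~ (0 < x < 1) -> G x = x by rewrite /G => /negbTE ->.
have dGout (x : R) : ~~ (0 < x < 1) -> dG x = 1 by rewrite /dG => /negbTE ->.
exists G, dG; split => //.
have inv_d t : is_derive (psi t) 1 i (q t)^-1.
  apply: is_derive_inverse => //; last by rewrite gt_eqF.
  - by near=> u; exact: iK.
  - by near=> u; exact: C1pos_continuous psiC _.
have near_in (x : R) : 0 < x < 1 -> \forall y \near x, 0 < y < 1.
  by move=> /andP[x0 x1]; near=> y; apply/andP; split; near: y;
    [exact: lt_nbhsr|exact: lt_nbhsl].
have near_out (x : R) : ~~ (0 <= x <= 1) -> \forall y \near x, ~~ (0 < y < 1).
  rewrite negb_and -!ltNge => /orP[x0|x1]; near=> y; rewrite negb_and -!leNgt;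
    apply/orP; [left|right]; apply/ltW; near: y.
    exact: lt_nbhsl.
  exact: lt_nbhsr.
have Gd_in (x : R) : 0 < x < 1 -> is_derive x 1 G (dG x).
  move=> xI; rewrite -(iP x xI) dGpsi; set t := i x.
  have sid : is_derive (psi t) 1 (fun u => i u + s) (q t)^-1.
    by have := is_derive1D (inv_d t) (is_derive_cst s (psi t) 1); rewrite addr0.
  have := @is_derive1_comp R psi (fun u => i u + s) (psi t) (q (t + s)) (q t)^-1.
  rewrite iK => /(_ (psid _) sid); apply: near_eq_is_derive.
  have := near_in _ (psi01 t); apply: filterS => y yI.
  by rewrite /G yI.
have Gd_out (x : R) : ~~ (0 <= x <= 1) -> is_derive x 1 G (dG x).
  move=> xI; have := near_out _ xI => n.
  rewrite dGout; last exact: (nbhs_singleton n).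
  apply: near_eq_is_derive (is_derive_id x 1).
  by apply: filterS n => y yI; rewrite Gout.
have ends (x : R) : 0 < x < 1 \/ ~~ (0 <= x <= 1) \/ x = 0 \/ x = 1.
  have [xI|xI] := boolP (0 < x < 1); first by left.
  right; have [xI'|] := boolP (0 <= x <= 1); last by left.
  right; move: xI' xI => /andP[]; rewrite le_eqVlt => /predU1P[<-|x0]; first by left.
  by rewrite le_eqVlt => /predU1P[->|x1]; [right|rewrite x0 x1].
(* Points of (0, 1) close to an endpoint have large parameters, positive or negative. *)
have far (x T : R) : x = 0 \/ x = 1 -> \forall y \near x, 0 < y < 1 -> T < `|i y|.
  move=> xE; pose S := `|T| + 1.
  have S0 : 0 < S by rewrite ltr_pwDr.
  have TS : T < S by rewrite /S (le_lt_trans (ler_norm T))// ltrDl.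
  have small (y : R) : 0 < y < 1 -> y < psi (- S) -> T < `|i y|.
    move=> yI; rewrite -{1}(iP y yI) lt_psi => iS.
    by rewrite ltr0_norm; lra.
  have big (y : R) : 0 < y < 1 -> psi S < y -> T < `|i y|.
    move=> yI; rewrite -{1}(iP y yI) lt_psi => iS.
    by rewrite gtr0_norm; lra.
  case: xE => ->.
    near=> y => yI; apply: small => //; near: y; apply: lt_nbhsl.
    by case/andP: (psi01 (- S)).
  near=> y => yI; apply: big => //; near: y; apply: lt_nbhsr.
  by case/andP: (psi01 S).
have near_dist (x e : R) : 0 < e -> \forall y \near x, `|x - y| < e.
  by move=> e0; apply/nbhs_ballP; exists e.
have Gc : continuous G.
  move=> x; have [xI|[xI|]] := ends x.
  - exact: is_derive_continuous (Gd_in x xI).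
  - exact: is_derive_continuous (Gd_out x xI).
  move=> xE.
  have Gx : G x = x by apply: Gout; case: xE => ->; rewrite ltxx ?andbF.
  apply/cvgrPdist_lt => e e0; rewrite Gx.
  have [t [_ te]] := psiT e e0.
  (* Below [psi (- t - s)] the shifted parameter stays below [- t], so [G y < e]. Near 1,
     [y <= G y < 1] suffices because [s] is nonnegative. *)
  have psi_ts : 0 < psi (- t - s) by case/andP: (psi01 (- t - s)).
  case: xE => ->.
    near=> y.
    have ye : `|0 - y| < e by near: y; exact: near_dist.
    have yts : y < psi (- t - s) by near: y; exact: lt_nbhsl.
    rewrite /G; case: ifPn => // yI.
    rewrite sub0r normrN gtr0_norm; last by case/andP: (psi01 (i y + s)).
    apply: lt_trans te; rewrite lt_psi.
    by move: yts; rewrite -{1}(iP y yI) lt_psi; lra.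
  near=> y.
  have ye : `|1 - y| < e by near: y; exact: near_dist.
  rewrite /G; case: ifPn => // yI.
  have /andP[_ p1] := psi01 (i y + s).
  rewrite gtr0_norm ?subr_gt0//; have /andP[_ y1] := yI.
  move: ye; rewrite gtr0_norm ?subr_gt0//; apply: le_lt_trans.
  by rewrite lerD2l lerN2 -{1}(iP y yI) (C1pos_le psiC) lerDl.
have dGc : continuous dG.
  move=> x; have [xI|[xI|xE]] := ends x.
  - rewrite /continuous_at -{2}(iP x xI) dGpsi.
    have ic : {for x, continuous i}.
      by rewrite -(iP x xI); exact: is_derive_continuous (inv_d (i x)).
    have : (q (i y + s) / q (i y)) @[y --> x] --> q (i x + s) / q (i x).
      apply: cvgM.
        apply: (@continuous_comp _ _ _ (fun y => i y + s) q); last exact: qc.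
        by apply: cvgD; [exact: ic|exact: cvg_cst].
      apply: cvgV; first by rewrite gt_eqF.
      by apply: (@continuous_comp _ _ _ i q) => //; exact: qc.
    apply: cvg_trans; apply: near_eq_cvg.
    by have := near_in _ xI; apply: filterS => y yI; rewrite /dG yI.
  - rewrite /continuous_at dGout; last exact: (nbhs_singleton (near_out _ xI)).
    have : (fun=> 1 : R) @ x --> (1 : R) by exact: cvg_cst.
    apply: cvg_trans; apply: near_eq_cvg.
    by have := near_out _ xI; apply: filterS => y yI; rewrite dGout.
  - apply/cvgrPdist_le => e e0.
    rewrite dGout; last by case: xE => ->; rewrite ltxx ?andbF.
    have [T HT] := qT e e0.
    have := far x T xE; apply: filterS => y; rewrite /dG.
    case: ifPn => [yI /(_ isT) /HT|_ _]; first by rewrite distrC.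
    by rewrite subrr normr0 ltW.
split=> // x.
- have [xI|[xI|xE]] := ends x; [exact: Gd_in|exact: Gd_out|].
  (* At an endpoint the derivative is the limit of the derivatives nearby; the radius 1 keeps the
     other endpoint away. *)
  apply: is_derive_removable => //; first exact: dGc.
  have : \forall y \near x^', y != x by exact: nbhs_dnbhs_neq.
  have : \forall y \near x^', `|x - y| < 1 by apply: nbhs_dnbhs; exact: near_dist.
  apply: filterS2 => y yd yx.
  have [/Gd_in//|[/Gd_out//|yE]] := ends y.
  by move: yx yd; case: xE => ->; case: yE => ->;
    rewrite ?eqxx// ?sub0r ?subr0 ?normrN normr1 ltxx.
- rewrite /dG; case: ifP => // _; first by rewrite divr_gt0.
Unshelve. all: by end_near. Qed.

End conjugated_shift.

(** * Estimates near the endpoints *)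

Section roots.
Variable R : realType.
Implicit Types (F dF phi Q : R -> R).

(** Near 0 the mean value theorem gives [F x = dF c * x] with [dF c] close to 1, while [1 - x] and
    [1 - F x] are both close to 1. Near 1 the roles are exchanged. *)
Lemma end_behaviour F dF l :
    C1pos F dF -> F 0 = 0 -> F 1 = 1 -> dF 0 = 1 -> dF 1 = 1 ->
    (forall x, 0 < x < 1 -> x < F x) -> 1 < l ->
  exists2 d, 0 < d & forall x, 0 < x < 1 -> x < d \/ 1 - d < x ->
    [/\ within_factor l 1 (dF x), within_factor l x (F x)
      & within_factor l (1 - x) (1 - F x)].
Proof.
move=> FC F0 F1 dF0 dF1 Flt l1; have [Fd dFc dFp] := FC.
have Fc := C1pos_continuous FC.
have l0 : 0 < l by exact: lt_trans l1.
have dFn (x : R) : dF x = 1 -> \forall y \near x, within_factor l 1 (dF y).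
  move=> dx; near=> y; apply/andP; split; apply/ltW.
    rewrite -ltr_pdivrMl// mulr1; near: y.
    by apply: (dFc x [set z | l^-1 < z]); apply: lt_nbhsr; rewrite dx invf_lt1.
  rewrite mulr1; near: y.
  by apply: (dFc x [set z | z < l]); apply: lt_nbhsl; rewrite dx.
have near0 : \forall y \near (0 : R), 0 < l * (1 - F y) - (1 - y).
  have c : (l * (1 - F y) - (1 - y)) @[y --> (0 : R)] --> l * (1 - F 0) - (1 - 0).
    apply: cvgB; last by apply: cvgB; [exact: cvg_cst|exact: cvg_id].
    by apply: cvgMr; apply: cvgB; [exact: cvg_cst|exact: Fc].
  by apply: (c [set z | 0 < z]); apply: lt_nbhsr; rewrite F0; lra.
have near1 : \forall y \near (1 : R), 0 < l * y - F y.
  have c : (l * y - F y) @[y --> (1 : R)] --> l * 1 - F 1.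
    by apply: cvgB; [apply: cvgMr; exact: cvg_id|exact: Fc].
  by apply: (c [set z | 0 < z]); apply: lt_nbhsr; rewrite F1; lra.
have /nbhs_ballP[d0 /= d00 H0] : \forall y \near (0 : R),
    within_factor l 1 (dF y) /\ 0 < l * (1 - F y) - (1 - y).
  exact: filterI (dFn 0 dF0) near0.
have /nbhs_ballP[d1 /= d10 H1] : \forall y \near (1 : R),
    within_factor l 1 (dF y) /\ 0 < l * y - F y.
  exact: filterI (dFn 1 dF1) near1.
have Fw a b : {within `[a, b], continuous F} by exact: continuous_subspaceT.
exists (Num.min d0 d1); first by rewrite lt_min d00.
move=> x xI; have /andP[x0 x1] := xI; have xF := Flt x xI.
have Fx1 : F x < 1 by rewrite -[ltRHS]F1 (C1pos_lt FC).
case=> xd.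
- have ball0 (y : R) : 0 <= y <= x -> ball (0 : R) d0 y.
    move=> /andP[y0 yx]; rewrite /ball/= sub0r normrN ger0_norm//.
    by apply: (le_lt_trans yx); move: xd; rewrite lt_min => /andP[].
  have [Hx Hx'] := H0 x (ball0 x ltac:(by rewrite lexx ltW)).
  have [c] := @MVT R F dF _ _ x0 (fun z _ => Fd z) (Fw 0 x).
  rewrite in_itv/= F0 !subr0 => /andP[c0 cx] E.
  have [/andP[_ Hc] _] := H0 c (ball0 c ltac:(by rewrite !ltW)).
  split => //; rewrite /within_factor.
    by apply/andP; split; [nra|rewrite E; nra].
  by apply/andP; split; nra.
- have ball1 (y : R) : x <= y <= 1 -> ball (1 : R) d1 y.
    move=> /andP[xy y1]; rewrite /ball/= ger0_norm ?subr_ge0//.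
    have : Num.min d0 d1 <= d1 by rewrite ge_min lexx orbT.
    by lra.
  have [Hx Hx'] := H1 x (ball1 x ltac:(by rewrite lexx ltW)).
  have [c] := @MVT R F dF _ _ x1 (fun z _ => Fd z) (Fw x 1).
  rewrite in_itv/= F1 => /andP[xc c1] E.
  have [/andP[Hc _] _] := H1 c (ball1 c ltac:(by rewrite !ltW)).
  split => //; rewrite /within_factor.
    by apply/andP; split; nra.
  rewrite E; apply/andP; split; last by rewrite -E; nra.
  by rewrite mulrA ler_peMl// subr_ge0 ltW.
Unshelve. all: by end_near. Qed.

(** One [t] serves both ends, since [denom] is even and the arctangent odd. [conumer] at [t] and
    [numer] at [- t] stay below 2 while [denom] grows. *)
Lemma psi_unbounded phi k eta e : (forall t, 0 < phi t < 1) -> 0 < k ->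
    0 < eta < 1 -> 0 < e ->
  exists t, 1 - psi phi k eta t < e /\ psi phi k eta (- t) < e.
Proof.
move=> phi01 k0 /andP[e0 e1] ep; have pi0 := pi_gt0 R.
have : \forall t \near +oo, `|pi / 2 - atan t| < pi * e.
  by move/cvgrPdist_lt : (@cvgy_atan R); apply; rewrite mulr_gt0.
(* As [denom] is at least [eta * (1 + k * t)], this threshold makes [e * denom] exceed 2. *)
have : \forall t \near +oo, Num.max 0 (2 / (eta * k * e)) < t.
  by apply: nbhs_pinfty_gt; exact: num_real.
move=> h1 h2; have [t [t1 t2]] := filter_ex (filterI h1 h2).
move: t1; rewrite gt_max => /andP[t0]; rewrite ltr_pdivrMr ?mulr_gt0// => t1.
have at1 : 1 / 2 - atan t / pi < e.
  rewrite (_ : 1 / 2 - _ = (pi / 2 - atan t) / pi); last first.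
    by have := lt0r_neq0 pi0; move: (pi) => p pn; field.
  by rewrite ltr_pdivrMr// [ltRHS]mulrC; apply: le_lt_trans t2; exact: ler_norm.
have ee : expR (- k * t) <= 1 by rewrite -[leRHS](@expR0 R) ler_expR mulNr oppr_le0 mulr_ge0// ltW.
have D0 := denom_gt0 k t (ltW e0).
have De : 2 < e * denom k eta t.
  have := denom_ge k t (ltW e0); rewrite (gtr0_norm t0).
  have := expR_ge1Dx (k * t) => h h'.
  have : eta * (1 + k * t) <= denom k eta t by apply: le_trans h'; rewrite ler_pM2l.
  move=> h''; have : e * (eta * (1 + k * t)) <= e * denom k eta t by rewrite ler_pM2l.
  have : 0 < e * eta by rewrite mulr_gt0.
  by move: t1; nra.
have DN : denom k eta (- t) = denom k eta t.
  by rewrite /denom mulrNN mulrN -mulNr [expR _ + _]addrC.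
have conv (x y : R) : x < e -> y < e -> (1 - eta) * x + eta * y < e.
  by move=> xe ye; nra.
have /andP[p0 p1] := phi01 t; have /andP[p0' p1'] := phi01 (- t).
have em0 := expR_gt0 (- k * t).
exists t; split.
  rewrite /psi (_ : 1 - _ = (1 - eta) * (conumer phi k eta t / denom k eta t)
    + eta * (1 / 2 - atan t / pi)); last first.
    have -> : conumer phi k eta t = denom k eta t - numer phi k eta t.
      by rewrite (denomE phi); ring.
    have := lt0r_neq0 D0; have := lt0r_neq0 pi0.
    by move: (denom _ _ _) (numer _ _ _ _) (pi) => D A p pn Dn; field; apply/andP.
  apply: conv => //; rewrite ltr_pdivrMr//; apply: le_lt_trans De.
  by rewrite /conumer; nra.
rewrite /psi atanN mulNr; apply: conv => //.
rewrite DN ltr_pdivrMr//; apply: le_lt_trans De.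
by rewrite /numer mulrN -mulNr; nra.
Qed.

End roots.

(** * Construction of the approximate roots *)

Section roots_main.
Variable R : realType.
Implicit Types (F dF phi Q : R -> R).

(** Differentiating the functional equation of [phi] gives the recursion for [Q]. Its multiplier is
    within [expR k] of 1 far out, so [subexponential] applies to [Q] and to its reflection. *)
Lemma orbit_growth F dF phi Q k m :
    C1pos F dF -> C1pos phi Q -> (forall t, phi (t + 1) = F (phi t)) ->
    0 <= m ->
    (forall t, m <= `|t| -> within_factor (expR k) 1 (dF (phi t))) ->
  (forall t, Q (t + 1) = dF (phi t) * Q t) /\
  exists C, forall t, Q t <= C * expR (k * `|t|).
Proof.
move=> [Fd _ _] [phid Qc Q0] phiS m0 slow.
have QS t : Q (t + 1) = dF (phi t) * Q t.
  have d1 := @is_derive1_comp R phi (fun u => u + 1) t _ 1 (phid (t + 1)).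
  have {d1} := d1 _; rewrite mulr1 => d1.
  have d2 := is_derive1_comp (Fd (phi t)) (phid t).
  have E : phi \o (fun u => u + 1) = F \o phi by apply/funext => u /=.
  have {}d1 : is_derive t 1 (F \o phi) (Q (t + 1)).
    rewrite -E; apply: d1.
    by have := is_derive1D (is_derive_id t 1) (is_derive_cst (1 : R) t 1); rewrite addr0.
  by rewrite -(@derive_val _ _ _ _ _ _ _ d1) (@derive_val _ _ _ _ _ _ _ d2).
split=> //.
have [|C1 H1] := @subexponential R Q k m Qc m0.
  move=> t mt; rewrite QS ler_pM2r//.
  have t0 : 0 <= t by exact: le_trans mt.
  by have /andP[_] := slow t (le_trans mt (ler_norm t)); rewrite mulr1.
have Qc' : continuous (fun t => Q (- t)).
  by move=> t; apply: (@continuous_comp _ _ _ (fun t => - t) Q);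
    [exact: opp_continuous|exact: Qc].
have [|C2 H2] := @subexponential R (fun t => Q (- t)) k m Qc' m0.
  move=> t mt.
  have -> : - t = - (t + 1) + 1 by ring.
  have t0 : 0 <= t + 1 by rewrite addr_ge0// (le_trans m0).
  have /slow/andP[a _] : m <= `|- (t + 1)|.
    by rewrite normrN ger0_norm// (le_trans mt)// lerDl.
  by rewrite QS mulrA ler_peMl// ltW.
exists (C1 + C2) => t.
have C10 : 0 <= C1.
  by have := H1 0 (lexx 0); rewrite mulr0 expR0 mulr1; apply: le_trans; exact: ltW.
have C20 : 0 <= C2.
  by have := H2 0 (lexx 0); rewrite mulr0 expR0 mulr1; apply: le_trans; exact: ltW.
rewrite mulrDl; case: (ger0P t) => t0.
  by rewrite (le_trans (H1 t t0))// lerDl mulr_ge0// expR_ge0.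
have := H2 (- t); rewrite oppr_ge0 opprK ltW// => /(_ isT) H.
by rewrite (le_trans H)// lerDr mulr_ge0// expR_ge0.
Qed.

Lemma iter_conj_shift (psi : R -> R) (G : R -> R) s n :
  (forall t, G (psi t) = psi (t + s)) ->
  forall t, iter n G (psi t) = psi (t + n%:R * s).
Proof.
move=> GS t; elim: n => [|n IH]; first by rewrite mul0r addr0.
by rewrite iterS IH GS -natr1 mulrDl mul1r addrA.
Qed.

(** [G] is the conjugate of the shift by 1/N, and its N-th iterate that of the unit shift. For [G]
    to be near the identity, the tail hypothesis handles large [|t|], and uniform continuity in [s]
    at 0 handles the rest. *)
Lemma flow_roots (psi q : R -> R) r :
    C1pos psi q -> (forall t, 0 < psi t < 1) ->
    (forall e, 0 < e -> exists t, 1 - psi t < e /\ psi (- t) < e) ->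
    (forall e, 0 < e -> exists T, forall t s, T < `|t| -> 0 <= s <= 1 ->
       within_factor (1 + e) (q t) (q (t + s))) ->
    0 < r ->
  exists N G dG dH, [/\ (0 < N)%N, C1pos G dG, C1pos (iter N G) dH,
      forall x, ~~ (0 < x < 1) -> [/\ G x = x, dG x = 1 & dH x = 1]
    & (forall x, `|dG x - 1| <= r) /\ forall t, dH (psi t) = q (t + 1) / q t].
Proof.
move=> psiC psi01 psiT qT r0; have [_ qc q0] := psiC.
have qT' s : 0 <= s <= 1 -> forall e, 0 < e ->
    exists T, forall t, T < `|t| -> `|q (t + s) / q t - 1| <= e.
  move=> sI e e0; have [T HT] := qT e e0; exists T => t tT.
  by have := factor_ratio (q0 t) (q0 (t + s)) (HT t s tT sI); rewrite addrAC subrr add0r.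
have [T HT] := qT r r0.
have : \forall s \near (0 : R), forall t, - `|T| <= t <= `|T| ->
    `|q (t + s) / q t - 1| < r.
  apply: (@compact_near_param R (fun s t => q (t + s) / q t - 1)) => t _ /=.
    apply: cvgB; last exact: cvg_cst.
    apply: cvgM.
      apply: (@continuous_comp _ _ _ (fun z : R * R => z.1 + z.2) q); last exact: qc.
      by apply: cvgD; [exact: cvg_fst|exact: cvg_snd].
    apply: cvgV; first by rewrite gt_eqF.
    by apply: (@continuous_comp _ _ _ fst q); [exact: cvg_fst|exact: qc].
  by rewrite addr0 divff ?gt_eqF// subrr normr0.
move=> /nbhs_ballP[d /= d0 Hd].
pose N := (Num.truncn d^-1).+1.
pose s := N%:R^-1 : R.
have N0 : 0 < N%:R :> R by rewrite ltr0n.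
have s0 : 0 < s by rewrite invr_gt0.
have s1 : s <= 1 by rewrite invf_le1// ler1n.
have sd : s < d.
  by rewrite -[ltRHS]invrK ltf_pV2 ?posrE ?invr_gt0// truncnS_gt.
have sI : 0 <= s <= 1 by rewrite (ltW s0).
have small t : `|q (t + s) / q t - 1| <= r.
  have [tT|tT] := leP `|t| `|T|.
    apply/ltW/Hd; last by rewrite -ler_norml.
    by rewrite /ball/= sub0r normrN gtr0_norm.
  have := HT t s (le_lt_trans (ler_norm T) tT) sI.
  move/(factor_ratio (q0 t) (q0 (t + s))).
  by rewrite addrAC subrr add0r.
have [G [dG [GC GS dGS Gout dGout]]] :=
  conj_shift psiC psi01 psiT (ltW s0) (qT' s sI).
have [|H [dH [HC HS dHS Hout dHout]]] :=
  @conj_shift R psi q 1 psiC psi01 psiT ler01 (qT' 1 _).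
  by rewrite ler01 lexx.
have GH : iter N G = H.
  apply/funext => x; have [xI|xI] := boolP (0 < x < 1).
    have [t <-] := C1pos_onto_unit psiC psiT xI.
    by rewrite (iter_conj_shift N GS) HS mulfV// gt_eqF.
  rewrite Hout//; elim: (N) => //= n ->; exact: Gout.
exists N, G, dG, dH; split; rewrite ?GH//.
  by move=> x xI; split; [exact: Gout|exact: dGout|exact: dHout].
split=> // x; have [xI|xI] := boolP (0 < x < 1).
  have [t <-] := C1pos_onto_unit psiC psiT xI.
  by rewrite dGS.
by rewrite dGout// subrr normr0 ltW.
Qed.

(** At [eta = 0] the difference is [Q (t + 1) / Q t - dF (phi t)], which vanishes. *)
Lemma speed_ratio_near F dF phi Q k m r :
    C1pos F dF -> C1pos phi Q -> (forall t, 0 < phi t < 1) -> 0 < k ->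
    (forall t, Q (t + 1) = dF (phi t) * Q t) -> 0 < r ->
  \forall eta \near (0 : R), forall t, - m <= t <= m ->
    `|speed phi Q k eta (t + 1) / speed phi Q k eta t - dF (psi phi k eta t)| < r.
Proof.
move=> [_ dFc _] phiC phi01 k0 QS r0; have [_ _ Q0] := phiC.
apply: (@compact_near_param R (fun eta t =>
  speed phi Q k eta (t + 1) / speed phi Q k eta t - dF (psi phi k eta t))) => t _.
  have sc (u : R) : {for (u, 0 : R), continuous (fun z : R * R => speed phi Q k z.2 z.1)}.
    exact: (continuous_speed2 phiC).
  apply: cvgB.
    apply: cvgM; last first.
      by apply: cvgV; [rewrite /= speed0 gt_eqF|exact: sc].
    apply: (@continuous_comp (R * R)%type (R * R)%type R
      (fun z : R * R => (z.1 + 1, z.2)) (fun z : R * R => speed phi Q k z.2 z.1)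
      (t, 0) _ (sc (t + 1))).
    apply: (@cvg_pair _ R R (nbhs (t, 0 : R)) (nbhs (t + 1)) (nbhs (0 : R)) _ _ _
      (fun z => z.1 + 1) snd).
      by apply: cvgD; [exact: cvg_fst|exact: cvg_cst].
    exact: cvg_snd.
  apply: (@continuous_comp _ _ _ (fun z : R * R => psi phi k z.2 z.1) dF).
    exact: (continuous_psi2 phiC).
  exact: dFc.
by rewrite !speed0 psi0 QS mulfK ?subrr ?normr0// gt_eqF.
Qed.

(** The constants are fixed in the order [k], [d], [m], [eta]: the tail estimate at [|t| > m] must
    hold for every [eta] in (0, 1) before [eta] is made small on the compact part. *)
Lemma C1pos_roots F dF r :
    C1pos F dF -> (forall x, ~~ (0 < x < 1) -> F x = x) ->
    (forall x, ~~ (0 < x < 1) -> dF x = 1) ->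
    (forall x, 0 < x < 1 -> x < F x) -> 0 < r ->
  exists N G dG dH, [/\ (0 < N)%N, C1pos G dG, C1pos (iter N G) dH,
      G 0 = 0 /\ G 1 = 1
    & forall x, `|dG x - 1| <= r /\ `|dH x - dF x| <= r].
Proof.
move=> FC Fout dFout Flt r0.
have out0 : ~~ ((0 : R) < (0 : R) < (1 : R)) by rewrite ltxx.
have out1 : ~~ ((0 : R) < (1 : R) < (1 : R)) by rewrite ltxx andbF.
have [phi [Q [phiC phi01 phiS phi1 phi0]]] := orbit_param FC Fout Flt.
pose r1 := r / 2; have r10 : 0 < r1 by rewrite divr_gt0.
(* The fourth power in [factor_speed] becomes exactly [1 + r / 2]. *)
pose k := ln (1 + r1) / 4.
have k0 : 0 < k by rewrite divr_gt0// ln_gt0// ltrDl.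
have lr : expR k ^+ 4 = 1 + r1.
  by rewrite -expRM_natl /k mulrC divfK// lnK// posrE addr_gt0.
(* The orbit is controlled at half the rate of the exponentials in [denom], as [speed_tail]
   requires. *)
have k20 : 0 < k / 2 by rewrite divr_gt0.
have l1 : 1 < expR k by rewrite -[ltLHS](@expR0 R) ltr_expR.
have l21 : 1 < expR (k / 2) by rewrite -[ltLHS](@expR0 R) ltr_expR.
have l2l : expR (k / 2) <= expR k by rewrite ler_expR; lra.
have [d d0 dH] := end_behaviour FC (Fout 0 out0) (Fout 1 out1)
  (dFout 0 out0) (dFout 1 out1) Flt l21.
have [dFc_ _ dF0] := FC.
have dFnear x : 0 < x < 1 -> x < d \/ 1 - d < x -> `|dF x - 1| <= r1.
  move=> xI xd; have [a _ _] := dH x xI xd.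
  have := factor_ratio ltr01 (dF0 x) a; rewrite divr1 => /le_trans; apply.
  have : expR k <= expR k ^+ 4 by rewrite exprS ler_peMr ?exprn_ege1// ltW// expR_gt0.
  by rewrite lr; lra.
(* The margin [d / 2] leaves room for replacing [phi] by [psi], which moves points of [-m, m] by
   less than [d / 2]. *)
have [ta pa] : exists t, 1 - d / 2 < phi t by apply: phi1; lra.
have [tb pb] : exists t, phi t < d / 2 by apply: phi0; rewrite divr_gt0.
have [|T T0 HT] := @atan_speed_tail R (expR k - 1); first by rewrite subr_gt0.
pose m := `|ta| + `|tb| + T + 1.
have m0 : 0 <= m by rewrite !addr_ge0.
have Tm : T < m by rewrite /m; have := normr_ge0 ta; have := normr_ge0 tb; lra.
have pm : 1 - d / 2 < phi m.
  apply: (lt_trans pa); rewrite (C1pos_lt phiC) /m.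
  by have := ler_norm ta; have := normr_ge0 tb; lra.
have pNm : phi (- m) < d / 2.
  apply: lt_trans pb; rewrite (C1pos_lt phiC) /m.
  by have := ler_norm (- tb); have := normr_ge0 ta; rewrite normrN; lra.
have far t : m <= `|t| -> phi t < d / 2 \/ 1 - d / 2 < phi t.
  rewrite ler_normr => /orP[mt|mt]; [right|left].
    by apply: (lt_le_trans pm); rewrite (C1pos_le phiC).
  by apply: le_lt_trans pNm; rewrite (C1pos_le phiC) lerNr.
have far' t : m <= `|t| -> phi t < d \/ 1 - d < phi t.
  by move=> /far[]; [left|right]; lra.
have slow t : m <= `|t| -> within_factor (expR (k / 2)) 1 (dF (phi t)).
  by move=> /far' tf; have [] := dH _ (phi01 t) tf.
have [QS [C QC]] := orbit_growth FC phiC phiS m0 slow.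
have psi_near : \forall eta \near (0 : R), forall t, - m <= t <= m ->
    `|psi phi k eta t - phi t| < d / 2.
  apply: (@compact_near_param R (fun eta t => psi phi k eta t - phi t)) => t _ /=.
    apply: cvgB; first exact: (continuous_psi2 phiC).
    apply: (@continuous_comp _ _ _ fst phi); first exact: cvg_fst.
    exact: C1pos_continuous phiC _.
  by rewrite psi0 subrr normr0 divr_gt0.
have ratio_near := speed_ratio_near m FC phiC phi01 k0 QS r0.
have [eta [eta_gt0 eta_lt1 Hpsi Hq]] : exists eta, [/\ 0 < eta, eta < 1,
    forall t, - m <= t <= m -> `|psi phi k eta t - phi t| < d / 2
  & forall t, - m <= t <= m ->
    `|speed phi Q k eta (t + 1) / speed phi Q k eta t - dF (psi phi k eta t)| < r].
  have [e /= e0 He] := (nbhs_ballP (0 : R) _).1 (filterI psi_near ratio_near).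
  pose eta := Num.min e 1 / 2.
  have m1 : 0 < Num.min e 1 by rewrite lt_min e0 ltr01.
  have me : Num.min e 1 <= e by rewrite ge_min lexx.
  have m1' : Num.min e 1 <= 1 by rewrite ge_min lexx orbT.
  have [|a b] := He eta.
    by rewrite /ball/= sub0r normrN gtr0_norm /eta ?divr_gt0//; lra.
  have [? ?] : 0 < eta /\ eta < 1 by split; rewrite /eta; clear -m1 m1'; lra.
  by exists eta.
have etaI : 0 <= eta < 1 by rewrite ltW.
pose ps := psi phi k eta; pose q := speed phi Q k eta.
have psC : C1pos ps q by exact: psi_C1pos.
have ps01 t : 0 < ps t < 1 by exact: psi_itv.
have psT e : 0 < e -> exists t, 1 - ps t < e /\ ps (- t) < e.
  by apply: psi_unbounded => //; rewrite eta_gt0.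
have qT e : 0 < e -> exists T, forall t s, T < `|t| -> 0 <= s <= 1 ->
    within_factor (1 + e) (q t) (q (t + s)).
  by move=> e0; apply: (speed_tail phiC phi01 k0 _ e0 QC); rewrite eta_gt0.
have [N [G [dG [dH' [N0 GC HC Hout [dGr dHq]]]]]] := flow_roots psC ps01 psT qT r0.
exists N, G, dG, dH'; split => //.
  by have [? _ _] := Hout 0 out0; have [? _ _] := Hout 1 out1.
move=> x; split; first exact: dGr.
have [xI|xI] := boolP (0 < x < 1); last first.
  by have [_ _ ->] := Hout x xI; rewrite dFout// subrr normr0 ltW.
have [t <-] := C1pos_onto_unit psC psT xI.
rewrite dHq; have [tm|mt] := leP `|t| m.
  by apply/ltW/Hq; rewrite -ler_norml.
(* Outside [-m, m] both [q (t + 1) / q t] and [dF (ps t)] are within [r / 2] of 1. *)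
have [_ _ q0] := psC.
have mt' := ltW mt.
have [Hphi Hcophi] : within_factor (expR k) (phi t) (phi (t + 1)) /\
    within_factor (expR k) (1 - phi t) (1 - phi (t + 1)).
  have [_ b c] := dH _ (phi01 t) (far' t mt').
  have /andP[p0 p1] := phi01 t; have /andP[p0' p1'] := phi01 (t + 1).
  by rewrite !phiS in p0' p1' *; split; apply: factor_le l2l _ _ _;
    rewrite ?subr_ge0 ?ltW.
have HQ : within_factor (expR k) (Q t) (Q (t + 1)).
  have [_ _ Q0] := phiC.
  have := factorZ (ltW (Q0 t)) (slow t mt'); rewrite mulr1 [Q t * _]mulrC -QS.
  by apply: factor_le; rewrite // ltW.
have Ha : within_factor (expR k) (atan_speed t) (atan_speed (t + 1)).
  have := HT t 1 (lt_trans Tm mt); rewrite ler01 lexx => /(_ isT).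
  by rewrite addrC subrK.
have := factor_speed phiC phi01 k0 etaI HQ Hphi Hcophi Ha.
move=> /(factor_ratio (q0 t) (q0 (t + 1))); rewrite lr addrAC subrr add0r => qr.
(* Since [ps] is increasing, its values at [m] and [- m] already place [ps t] within [d] of an
   end. *)
have dr : `|dF (ps t) - 1| <= r1.
  apply: dFnear => //.
  have mm : - m <= m <= m by rewrite lexx andbT ge0_cp.
  have mm' : - m <= - m <= m by rewrite lexx ge0_cp.
  have := Hpsi m mm; have := Hpsi (- m) mm'; rewrite !ltr_norml.
  move=> /andP[_ b1] /andP[a2 _].
  move: mt'; rewrite ler_normr => /orP[mt'|mt']; [right|left].
    apply: (@lt_le_trans _ _ (ps m)); last by rewrite (C1pos_le psC).
    by rewrite /ps; clear -a2 pm; lra.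
  apply: (@le_lt_trans _ _ (ps (- m))); first by rewrite (C1pos_le psC) lerNr.
  by rewrite /ps; clear -b1 pNm; lra.
have -> : q (t + 1) / q t - dF (ps t) = (q (t + 1) / q t - 1) - (dF (ps t) - 1) by ring.
apply: (le_trans (ler_normB _ _)); rewrite (_ : r = r1 + r1); last by rewrite /r1 -splitr.
exact: lerD.
Qed.

End roots_main.

(** * Reduction by reflection, and conclusion *)

Section main.
Variable R : realType.
Implicit Types (F dF f : R -> R).

(** A change of sign of [F x - x] would produce a fixed point by the intermediate value theorem. *)
Lemma fixfree_sign F : continuous F -> (forall x, 0 < x < 1 -> F x <> x) ->
  (forall x, 0 < x < 1 -> x < F x) \/ (forall x, 0 < x < 1 -> F x < x).
Proof.
move=> Fc Ffix.
have [H|/existsNP[x /not_implyP[xI /negP]]] :=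
  pselect (forall x, 0 < x < 1 -> x < F x); first by left.
rewrite -leNgt => Fx; right => y yI; rewrite ltNge; apply/negP => Fy.
pose D z := F z - z.
have Dw a b : {within `[a, b], continuous D}.
  by apply: continuous_subspaceT => z; apply: cvgB; [exact: Fc|exact: cvg_id].
have Dx : D x <= 0 by rewrite subr_le0.
have Dy : 0 <= D y by rewrite subr_ge0.
have [c cI Dc] : exists2 c, 0 < c < 1 & D c = 0.
  move: xI yI => /andP[x0 x1] /andP[y0 y1].
  have [xy|/ltW yx] := leP x y.
    have [||c] := @IVT R D x y 0 xy; [exact: Dw| |].
      by rewrite ge_min Dx le_max Dy orbT.
    rewrite in_itv/= => /andP[xc cy] Dc; exists c => //.
    by rewrite (lt_le_trans x0 xc) (le_lt_trans cy y1).
  have [||c] := @IVT R D y x 0 yx; [exact: Dw| |].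
    by rewrite ge_min Dx orbT le_max Dy.
  rewrite in_itv/= => /andP[yc cx] Dc; exists c => //.
  by rewrite (lt_le_trans y0 yc) (le_lt_trans cx x1).
by apply: (Ffix c cI); apply/eqP; rewrite -subr_eq0; apply/eqP.
Qed.

Lemma fixfree_roots F dF r :
    C1pos F dF -> (forall x, ~~ (0 < x < 1) -> F x = x) ->
    (forall x, ~~ (0 < x < 1) -> dF x = 1) ->
    (forall x, 0 < x < 1 -> F x <> x) -> 0 < r ->
  exists N G dG dH, [/\ (0 < N)%N, C1pos G dG, C1pos (iter N G) dH,
      G 0 = 0 /\ G 1 = 1
    & forall x, `|dG x - 1| <= r /\ `|dH x - dF x| <= r].
Proof.
move=> FC Fout dFout Ffix r0.
have [Flt|Flt] := fixfree_sign (C1pos_continuous FC) Ffix.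
  exact: C1pos_roots FC Fout dFout Flt r0.
have flipI x : (0 < 1 - x < 1) = (0 < x < 1) by rewrite subr_gt0 gtrBl andbC.
have [|||N [G [dG [dH [N0 GC HC [G0 G1] close]]]]] :=
    @C1pos_roots R (flip F) (fun x => dF (1 - x)) r (C1pos_flip FC) _ _ _ r0.
- by move=> x xI; rewrite /flip Fout ?flipI// subKr.
- by move=> x xI; rewrite dFout// flipI.
- by move=> x xI; rewrite /flip ltrBrDr -ltrBrDl Flt// flipI.
exists N, (flip G), (fun x => dG (1 - x)), (fun x => dH (1 - x)); split => //.
- exact: C1pos_flip.
- by rewrite iter_flip; exact: C1pos_flip.
- by rewrite /flip subr0 subrr G0 G1 subr0 subrr.
- by move=> x; have := close (1 - x); rewrite subKr.
Qed.

End main.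

Unset Implicit Arguments.

Theorem lemma1p2 (R : realType) (f : R -> R)
  (hf : diffeo1 f)
  (hfix : forall x : R, 0 < x < 1 -> f x <> x)
  (hf0 : deriv_at f 0 = 1)
  (hf1 : deriv_at f 1 = 1)
  (r : R) (hr : 0 < r) :
  exists (g : R -> R) (N : nat),
    [/\ diffeo1 g,
        (0 < N)%N,
        C1_close r g id
      & C1_close r (iter N g) f].
Proof.
(* The bounds are requested at [r / 2] to get strict inequalities between suprema, by
   [C1_close_le]. *)
have r20 : 0 < r / 2 by rewrite divr_gt0.
have [|||N [g [dg [dh [N0 gC hC [g0 g1] close]]]]] :=
    fixfree_roots (diffeo1_C1pos hf hf0 hf1) _ _ _ r20.
- by move=> x xI; apply: ext01_fix => //; [exact: diffeo1_0|exact: diffeo1_1].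
- move=> x; rewrite negb_and -!leNgt /clamp01 /= => /orP[x0|x1].
    by rewrite min_r ?max_l// (le_trans x0).
  by rewrite min_l ?max_r.
- move=> x xI; rewrite /ext01 ifT; first exact: hfix.
  by case/andP: xI => x0 x1; rewrite !ltW.
exists g, N; split => //; first exact: C1pos_diffeo1 gC g0 g1.
  apply: C1_close_le => // x xu.
  rewrite (C1pos_deriv_at gC xu) (C1pos_deriv_at (C1pos_id R) xu).
  by have [] := close x.
apply: C1_close_le => // x xu; rewrite (C1pos_deriv_at hC xu).
by have [_] := close x; rewrite /= clamp01_id.
Qed.
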